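(* Let $T_n\sim\mathrm{UA}(n)$ and let $A_K(n)$ be the set of the $K$ most central vertices of $T_n$. Fix $c>1$, $\delta>0$, and set $$c' := c\left(1-e^{-1/c}\right)-\delta .$$ Then there exists a constant $C<\infty$ depending only on $c$ and $\delta$ such that for every $\varepsilon>0$ the following holds for all positive integers $K\ge (C/\varepsilon)\log(1/\varepsilon)$ and all large enough $n\ge n_0(K,\delta,c)$: $$\mathbb P\left(\left|A_{\lceil cK\rceil}(n)\cap\{0,1,\dots,K-1\}\right|\ge c'K\right)\ge 1-\varepsilon .$$
   Context: Uniform attachment (UA) tree: $T_0$ is a single node labeled $0$; given $T_{n-1}$ on nodes $\{0,\dots,n-1\}$, $T_n$ is obtained by adding a node labeled $n$ together with an edge from it to a node of $\{0,\dots,n-1\}$ chosen uniformly at random (independently of the past). $\mathrm{UA}(n)$ is the law of $T_n$; vertices are identified with their arrival-time labels. Centrality: for a vertex $v$ of a tree $T$, $\psi_T(v)$ is the size (number of vertices) of the largest connected component after removing $v$ and all edges incident to it. The $K$ most central vertices of $T$ are the $K$ vertices with the smallest values of $\psi_T$, ties broken uniformly at random. *)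

(* Defs.v *)
From mathcomp Require Import all_boot all_order all_fingroup all_algebra.
From mathcomp Require Import reals.

Set Implicit Arguments.
Unset Strict Implicit.
Unset Printing Implicit Defensive.

Import Order.TTheory GRing.Theory Num.Theory.
Local Open Scope ring_scope.

(* Graphs on the vertex set {0, ..., n}, given by their edge set. *)
Definition graph (n : nat) := {set {set 'I_n.+1}}.

Definition old_vertex {n : nat} (v : 'I_n.+1) : 'I_n.+2 :=
  widen_ord (leqnSn n.+1) v.

(* The new vertex is [ord_max], i.e. it carries the label n + 1. *)
Definition attach (n : nat) (T : graph n) (j : 'I_n.+1) : graph n.+1 :=
  [set ord_max; old_vertex j] |: [set old_vertex @: e | e : {set 'I_n.+1} in T].

(* [UA R n T] is the probability that T_n = T. *)
Fixpoint UA (R : realType) (n : nat) : graph n -> R :=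
  if n is m.+1 then fun T' : graph m.+1 =>
    \sum_(T : graph m) UA R T *
      \sum_(j < m.+1) m.+1%:R^-1 * (T' == attach T j)%:R
  else fun T : graph 0 => (T == set0)%:R.

Definition adj_without (n : nat) (T : graph n) (v : 'I_n.+1) : rel 'I_n.+1 :=
  fun x y => [&& x != v, y != v, x != y & [set x; y] \in T].

(* This is 0 when v is the only vertex. *)
Definition psi (n : nat) (T : graph n) (v : 'I_n.+1) : nat :=
  \max_(x : 'I_n.+1 | x != v) #|[set y | connect (adj_without T v) x y]|.

(* Ties are broken by the permutation s; for a uniform s this breaks all ties
   uniformly at random. *)
Definition more_central (n : nat) (T : graph n) (s : {perm 'I_n.+1})
    (u v : 'I_n.+1) : bool :=
  (psi T u < psi T v)%N || ((psi T u == psi T v) && (s u < s v)%N).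

Definition most_central (n : nat) (T : graph n) (s : {perm 'I_n.+1})
    (K : nat) : {set 'I_n.+1} :=
  [set v | (#|[set u | more_central T s u v]| < K)%N].

(* Probability of an event depending on T_n ~ UA(n) and on an independent
   uniform permutation s of the vertices. *)
Definition UA_prob (R : realType) (n : nat)
    (E : graph n -> {perm 'I_n.+1} -> bool) : R :=
  \sum_(T : graph n) UA R T *
    \sum_(s : {perm 'I_n.+1}) (n.+1)`!%:R^-1 * (E T s)%:R.

(* Main.v *)
Require Import Defs.
From mathcomp Require Import all_boot all_order all_fingroup all_algebra.
From mathcomp Require Import boolp reals sequences exp.
From mathcomp Require Import zify ring lra.

(* Let S_v be the number of descendants of v (itself included) when T_n is
   rooted at 0, and N = n + 1. If at most k vertices have S_v >= m and no v > 0
   has S_v > N - m, then all vertices with S_v >= m are among the k most central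
   ones: psi is at least N - S_v off the root, and at most N - m when S_v >= m.

   S_v comes from a Polya urn started with one white ball among v + 1, so
   P(S_v > s) = C(n - s, v) / C(n, v), about (1 - s / n)^v. With s about
   n / (c K), the expected number of v with S_v > s is about c K, and about
   c (1 - e^(-1/c)) K of them are less than K. For u < v the events S_u > s and
   S_v > s are negatively correlated unless v descends from u, which has
   probability 1 / (u + 1); hence both counts have variance O(K log K), and
   Chebyshev's inequality bounds the failure probability by O(log K / K).

   This suffices once K exceeds a constant. For smaller K the hypothesis on eps
   forces 1 - eps = O(1 / C), so it is enough to succeed with a probability
   bounded away from 0. This holds because the early tree may, with positive
   probability, consist of the K hubs 0, ..., K - 1 with many leaves each. *)

Set Implicit Arguments.
Unset Strict Implicit.
Unset Printing Implicit Defensive.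

Import Order.TTheory GRing.Theory Num.Theory.
Local Open Scope ring_scope.

(** * Increasing trees as parent maps *)

(** Trees of every size share one type: total maps, of which only the values up to the current time
    matter. The bound [i.-1] forces [p 0 = 0] and [p i < i] for positive [i]. *)
Definition parent_map (p : nat -> nat) := forall i, (p i <= i.-1)%N.

Definition reparent (p : nat -> nat) (k j : nat) : nat -> nat :=
  fun i => if i == k then j else p i.

(** [k] is fuel for the climb from [v] towards the root; labels drop at each step, so fuel [v]
    suffices. *)
Fixpoint descends_within (p : nat -> nat) (u k v : nat) : bool :=
  (u == v) ||
  (if k is k'.+1 then (0 < v)%N && descends_within p u k' (p v) else false).

Definition descends (p : nat -> nat) (u v : nat) : bool :=
  descends_within p u v v.

Definition subtree_size (p : nat -> nat) (n u : nat) : nat :=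
  \sum_(v < n.+1) descends p u v.

(** For a parent map [p m.+1 <= m], so [inord] never takes its default value. *)
Fixpoint tree_of (n : nat) (p : nat -> nat) : graph n :=
  if n is m.+1 return graph n then attach (tree_of m p) (inord (p m.+1))
  else set0.

Lemma parent_map0 : parent_map (fun=> 0%N).
Proof. by []. Qed.

Lemma parent_map_reparent p k j :
  parent_map p -> (j <= k)%N -> parent_map (reparent p k.+1 j).
Proof. by move=> hp hj i; rewrite /reparent; case: eqP => [->|]. Qed.

Lemma descends_within_fuel p u k k' v : parent_map p ->
  (v <= k)%N -> (v <= k')%N ->
  descends_within p u k v = descends_within p u k' v.
Proof.
move=> hp; elim: k k' v => [|k IH] [|k'] [|v] //= hk hk'.
by rewrite (IH k') //; have := hp v.+1; lia.
Qed.

Lemma descendsE p u v : parent_map p ->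
  descends p u v = (u == v) || (0 < v)%N && descends p u (p v).
Proof.
move=> hp; case: v => [|v]; first by rewrite /descends /= orbF.
rewrite /descends /=; congr (_ || _).
by apply: descends_within_fuel => //; exact: (hp v.+1).
Qed.

Lemma descends_refl p u : descends p u u.
Proof. by rewrite /descends; case: u => [|u] //=; rewrite eqxx. Qed.

Section Descendants.
Variables (p : nat -> nat) (hp : parent_map p).

Lemma parent_lt v : (0 < v)%N -> (p v < v)%N.
Proof. by have := hp v; lia. Qed.

Lemma descends_parent u v :
  (0 < v)%N -> u != v -> descends p u v = descends p u (p v).
Proof. by move=> v0 uv; rewrite (descendsE _ _ hp) (negPf uv) v0. Qed.

Lemma descends_le u v : descends p u v -> (u <= v)%N.
Proof.
elim/ltn_ind: v => v IH; rewrite (descendsE _ _ hp).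
case: eqP => [-> //|_] /= /andP[v0] /(IH _ (parent_lt v0)).
by have := parent_lt v0; lia.
Qed.

Lemma descends0 v : descends p 0 v.
Proof.
elim/ltn_ind: v => v IH; rewrite (descendsE _ _ hp).
by case: v IH => // v IH; rewrite (IH _ (parent_lt _)).
Qed.

(** The ancestors of [x] form a chain; as labels decrease, the climb from [x] meets [v] no later
    than [u]. *)
Lemma descends_comparable u v x :
  descends p u x -> descends p v x -> (u <= v)%N -> descends p u v.
Proof.
elim/ltn_ind: x => x IH hu hv uv.
have [vx|vx] := eqVneq v x; first by rewrite vx.
have vltx : (v < x)%N by have := descends_le hv; lia.
have x0 : (0 < x)%N by lia.
apply: (IH (p x)) => //; first exact: parent_lt.
- by rewrite -descends_parent //; lia.
- by rewrite -descends_parent.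
Qed.

(** [w] is the child of [v] on the path to [x]; its subtree is the component of [x] once [v] is
    removed. *)
Lemma descends_child v x : descends p v x -> v != x ->
  exists w, [/\ (0 < w)%N, (w <= x)%N, p w = v & descends p w x].
Proof.
elim/ltn_ind: x => x IH hv vx.
have x0 : (0 < x)%N by have := descends_le hv; lia.
have hv' : descends p v (p x) by rewrite -descends_parent.
have [e|ne] := eqVneq v (p x); first by exists x; split=> //; exact: descends_refl.
have [w [w0 wx pw dw]] := IH _ (parent_lt x0) hv' ne.
have wltx : (w < x)%N by have := parent_lt x0; lia.
exists w; split=> //; first lia.
by rewrite descends_parent //; lia.
Qed.

End Descendants.

Lemma eq_descends p q n u v : parent_map p -> parent_map q ->
  (forall i, (i <= n)%N -> p i = q i) -> (v <= n)%N ->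
  descends p u v = descends q u v.
Proof.
move=> hp hq pq; elim/ltn_ind: v => v IH vn.
rewrite (descendsE _ _ hp) (descendsE _ _ hq).
case: v IH vn => [|v] IH vn //=; rewrite -pq // IH //.
- exact: parent_lt.
- by have := parent_lt hp (ltn0Sn v); lia.
Qed.

Section Reparent.
Variables (p : nat -> nat) (n j : nat).
Hypotheses (hp : parent_map p) (jn : (j <= n)%N).

Lemma descends_reparent u v : (v <= n)%N ->
  descends (reparent p n.+1 j) u v = descends p u v.
Proof.
apply: eq_descends => //; first exact: parent_map_reparent.
by move=> i i_n; rewrite /reparent ifN //; lia.
Qed.

Lemma descends_reparent_new u : (u <= n)%N ->
  descends (reparent p n.+1 j) u n.+1 = descends p u j.
Proof.
move=> un; rewrite (descends_parent (parent_map_reparent hp jn)) //; last lia.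
by rewrite /reparent eqxx descends_reparent.
Qed.

Lemma subtree_size_reparent u : (u <= n)%N ->
  subtree_size (reparent p n.+1 j) n.+1 u = (subtree_size p n u + descends p u j)%N.
Proof.
move=> un; rewrite /subtree_size big_ord_recr /= descends_reparent_new //.
by congr addn; apply: eq_bigr => i _; rewrite descends_reparent // -ltnS.
Qed.

Lemma subtree_size_reparent_new :
  subtree_size (reparent p n.+1 j) n.+1 n.+1 = 1%N.
Proof.
rewrite /subtree_size big_ord_recr /= descends_refl big1 // => i _.
rewrite descends_reparent ?leq_ord //; apply/eqP; rewrite eqb0.
by apply/negP => /(descends_le hp); have := ltn_ord i; lia.
Qed.

End Reparent.

Lemma subtree_size0 p n : parent_map p -> subtree_size p n 0 = n.+1.
Proof.
move=> hp; rewrite /subtree_size (eq_bigr (fun=> 1%N)); last first.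
  by move=> i _; rewrite (descends0 hp).
by rewrite sum_nat_const card_ord muln1.
Qed.

Lemma subtree_size_le p n u : (subtree_size p n u <= n.+1)%N.
Proof.
rewrite -[n.+1 in leqRHS]card_ord -sum1_card /subtree_size.
by apply: leq_sum => i _; case: descends.
Qed.

Lemma subtree_sizeE p n u :
  subtree_size p n u = #|[set v : 'I_n.+1 | descends p u v]|.
Proof.
rewrite /subtree_size -sum1_card [RHS]big_mkcond /=; apply: eq_bigr => i _.
by rewrite inE; case: descends.
Qed.

(** * Edges of the tree of a parent map *)

Lemma tree_of_reparent n k p j :
  (n < k)%N -> tree_of n (reparent p k j) = tree_of n p.
Proof.
elim: n => [//|n IH] nk /=; rewrite IH //; last lia.
by rewrite /reparent ifN //; lia.
Qed.

Lemma mem_tree_of n p (e : {set 'I_n.+1}) : parent_map p ->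
  reflect (exists2 i : 'I_n.+1, (0 < i)%N & e = [set i; inord (p i)])
          (e \in tree_of n p).
Proof.
move=> hp; elim: n e => [|n IH] e /=.
  by rewrite inE; apply: (iffP idP) => // -[i]; case: i => [[]].
have oldE (i : 'I_n.+1) : (0 < i)%N ->
    old_vertex @: [set i; inord (p i)] =
    [set old_vertex i; inord (p (old_vertex i))] :> {set 'I_n.+2}.
  move=> i0; rewrite imsetU1 imset_set1; congr [set _; _].
  by apply/val_inj; rewrite /= !inordK //; have := hp i; have := ltn_ord i; lia.
have newE : old_vertex (inord (p n.+1)) = inord (p n.+1) :> 'I_n.+2.
  by apply/val_inj; rewrite /= !inordK //; have := hp n.+1; lia.
rewrite !inE; apply: (iffP orP) => [[/eqP ->|/imsetP[f /IH[i i0 ->] ->]]|].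
- by exists ord_max; rewrite //= newE.
- by exists (old_vertex i); rewrite ?oldE.
- move=> [i i0 ->]; have [iM|iM] := eqVneq (i : nat) n.+1.
    left; apply/eqP; rewrite newE; congr [set _; _]; last by rewrite iM.
    exact/val_inj.
  right; have i_n : (i < n.+1)%N by have := ltn_ord i; lia.
  have -> : i = old_vertex (Ordinal i_n) by exact/val_inj.
  by rewrite -oldE //; apply/imset_f/IH; exists (Ordinal i_n).
Qed.

(** * Centrality in terms of subtree sizes *)

Section Centrality.
Variables (n : nat) (p : nat -> nat) (hp : parent_map p).
Let T := tree_of n p.

Lemma parent_edge (y : 'I_n.+1) : (0 < y)%N ->
  [set y; inord (p y)] \in T.
Proof. by move=> y0; apply/mem_tree_of => //; exists y. Qed.

Lemma inord_parent (i : 'I_n.+1) : (inord (p i) : 'I_n.+1) = p i :> nat.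
Proof. by rewrite inordK //; have := hp i; have := ltn_ord i; lia. Qed.

Lemma edge_parent (x y : 'I_n.+1) : x != y -> [set x; y] \in T ->
  ((0 < x)%N /\ p x = y) \/ ((0 < y)%N /\ p y = x).
Proof.
move=> xy /(mem_tree_of _ hp)[i i0 /setP e].
have := e x; rewrite !inE eqxx /= => /esym/orP[]/eqP xE.
  left; subst i; split=> //; rewrite -inord_parent.
  have := e y; rewrite !inE eqxx orbT => /esym/orP[/eqP yx|/eqP -> //].
  by rewrite yx eqxx in xy.
right; have := e y; rewrite !inE eqxx orbT => /esym/orP[]/eqP yE.
  by subst i; split; rewrite // xE inord_parent.
by rewrite xE yE eqxx in xy.
Qed.

(** The non-descendants of [v] climb to the root without meeting [v], so they all lie in one
    component. *)
Lemma psi_ge (v : 'I_n.+1) : (0 < v)%N ->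
  (n.+1 - subtree_size p n v <= psi T v)%N.
Proof.
move=> v0; rewrite /psi (bigD1 ord0) /=; last by apply: contraTneq v0 => <-.
apply: leq_trans (leq_maxl _ _).
have -> : (n.+1 - subtree_size p n v)%N = #|~: [set w : 'I_n.+1 | descends p v w]|.
  by rewrite [in RHS]cardsCs setCK card_ord subtree_sizeE.
apply/subset_leq_card/subsetP => y; rewrite !inE.
elim/ltn_ind: {y}(val y) {-2}y (erefl (val y)) => k IH y yk hy.
have [y0|y0] := posnP y.
  have -> : y = ord0 by exact/val_inj.
  exact: connect0.
have yv : y != v by apply: contraNneq hy => ->; exact: descends_refl.
have hpy : ~~ descends p v (p y) by rewrite -descends_parent // eq_sym.
apply: (@connect_trans _ _ (inord (p y))).
  apply: (IH (p y)); rewrite /= ?inord_parent //.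
  by rewrite -yk; exact: parent_lt.
apply: connect1; apply/and4P; split=> //.
- apply: contraNneq hpy => <-; rewrite inord_parent; exact: descends_refl.
- apply/eqP => /(congr1 val); rewrite /= inord_parent.
  by have := parent_lt hp y0; lia.
- by rewrite setUC parent_edge.
Qed.

Lemma connect_sub_closed (v x : 'I_n.+1) (A : {set 'I_n.+1}) : x \in A ->
  (forall a b, a != v -> b != v -> a \in A -> (0 < b)%N -> p b = a -> b \in A) ->
  (forall a b, a != v -> b != v -> b \in A -> (0 < b)%N -> p b = a -> a \in A) ->
  (#|[set y | connect (adj_without T v) x y]| <= #|A|)%N.
Proof.
move=> xA Adown Aup; apply/subset_leq_card/subsetP => y; rewrite inE.
have cl : closed (adj_without T v) (mem A).
  apply: intro_closed.
    apply: sym_connect_sym => a b; rewrite /adj_without (eq_sym a b).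
    by rewrite setUC andbCA.
  move=> a b /and4P[av bv ab eab] aA.
  have [[a0 pa]|[b0 pb]] := edge_parent ab eab.
    exact: (Aup b a).
  exact: (Adown a b).
by move=> /(closed_connect cl) <-.
Qed.

(** Removing [v] leaves the subtrees of its children, which the second hypothesis bounds, and the
    complement of its own subtree, which the first one bounds. *)
Lemma psi_le (v : 'I_n.+1) m : (m <= subtree_size p n v)%N ->
  (forall w : 'I_n.+1, (0 < w)%N -> (subtree_size p n w <= n.+1 - m)%N) ->
  (psi T v <= n.+1 - m)%N.
Proof.
move=> mv hw; apply/bigmax_leqP => x xv.
have [vx|vx] := boolP (descends p v x).
  have vx' : (v : nat) != x by rewrite eq_sym.
  have [w [w0 wx pw dw]] := descends_child hp vx vx'.
  have wn : (w < n.+1)%N by have := ltn_ord x; lia.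
  pose W := Ordinal wn.
  apply: leq_trans (hw W w0); rewrite subtree_sizeE.
  apply: connect_sub_closed => [|a b av bv|a b av bv]; rewrite !inE //= => ha b0 pb.
    by rewrite (descendsE _ _ hp) pb ha b0 orbT.
  rewrite -pb -descends_parent //; apply: contraNneq av => wb.
  by apply/eqP/val_inj; rewrite /= -pb -wb.
apply: (@leq_trans (n.+1 - subtree_size p n v)); last by rewrite leq_sub2l.
have -> : (n.+1 - subtree_size p n v)%N = #|~: [set w : 'I_n.+1 | descends p v w]|.
  by rewrite [in RHS]cardsCs setCK card_ord subtree_sizeE.
apply: connect_sub_closed => [|a b av bv|a b av bv]; rewrite !inE //= => ha b0 pb.
  by rewrite (descends_parent hp b0) ?pb // eq_sym.
by rewrite -pb -descends_parent // eq_sym.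
Qed.

(** A vertex more central than a big [v] has [psi] at most [n.+1 - m] by [psi_le], hence is big
    itself by [psi_ge]. So fewer than [k] vertices precede [v], however [s] breaks ties. *)
Lemma big_subtrees_most_central (s : {perm 'I_n.+1}) m k : (m <= n.+1)%N ->
  (#|[set v : 'I_n.+1 | (m <= subtree_size p n v)%N]| <= k)%N ->
  (forall w : 'I_n.+1, (0 < w)%N -> (subtree_size p n w <= n.+1 - m)%N) ->
  [set v : 'I_n.+1 | (m <= subtree_size p n v)%N] \subset most_central T s k.
Proof.
move=> mn Lk hw; apply/subsetP => v; rewrite !inE => mv.
apply: leq_trans Lk; apply/proper_card/properP; split; last first.
  by exists v; rewrite !inE // /more_central !ltnn andbF.
apply/subsetP => u; rewrite !inE => uv.
have psiu : (psi T u <= n.+1 - m)%N.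
  apply: leq_trans (psi_le mv hw).
  by case/orP: uv => [/ltnW //|/andP[/eqP -> _]].
have [u0|u0] := posnP u; first by rewrite u0 subtree_size0.
by have := psi_ge u0; have := subtree_size_le p n u; lia.
Qed.

End Centrality.

(** * Expectations over the attachment process *)

Section Process.
Variable R : realType.
Implicit Types (f g : (nat -> nat) -> R) (p : nat -> nat).

Definition attach_mean k f p : R :=
  k.+1%:R^-1 * \sum_(j < k.+1) f (reparent p k.+1 j).

(* Conditional expectation of f after d further attachments, given the tree p
   on the vertices 0, ..., k. *)
Fixpoint expect k d f p : R :=
  if d is d'.+1 then attach_mean k (expect k.+1 d' f) p else f p.

(** The definition peels off the first attachment; peeling off the last one matches the recursion of
    [UA]. *)
Lemma expectSr k d f p :
  expect k d.+1 f p = expect k d (attach_mean (k + d) f) p.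
Proof.
elim: d k p => [|d IH] k p; first by rewrite /= addn0.
rewrite -addSnnS [LHS]/= [RHS]/= /attach_mean; congr (_ * _).
by apply: eq_bigr => j _; exact: IH.
Qed.

Lemma expect_add k d1 d2 f p :
  expect k (d1 + d2) f p = expect k d1 (expect (k + d1) d2 f) p.
Proof.
elim: d1 k p => [|d1 IH] k p; first by rewrite addn0.
rewrite -addSnnS /= /attach_mean; congr (_ * _).
by apply: eq_bigr => j _; exact: IH.
Qed.

Lemma expect_le k d f g p : parent_map p ->
  (forall q, parent_map q -> f q <= g q) -> expect k d f p <= expect k d g p.
Proof.
move=> hp fg; elim: d k p hp => [|d IH] k p hp /=; first exact: fg.
rewrite ler_wpM2l ?invr_ge0 ?ler0n //; apply: ler_sum => j _.
by apply/IH/parent_map_reparent => //; rewrite -ltnS.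
Qed.

Lemma eq_expect k d f g p : parent_map p ->
  (forall q, parent_map q -> f q = g q) -> expect k d f p = expect k d g p.
Proof.
by move=> hp fg; apply/le_anti/andP; split; apply: expect_le => // q hq;
  rewrite fg.
Qed.

Lemma expect_cst k d (c : R) p : expect k d (fun=> c) p = c.
Proof.
elim: d k p => [//|d IH] k p /=; rewrite /attach_mean.
under eq_bigr do rewrite IH.
by rewrite sumr_const card_ord -[c *+ _]mulr_natl mulKf // pnatr_eq0.
Qed.

Lemma expectD k d f g p :
  expect k d (fun q => f q + g q) p = expect k d f p + expect k d g p.
Proof.
elim: d k p => [//|d IH] k p /=; rewrite /attach_mean -mulrDr -big_split /=.
by congr (_ * _); apply: eq_bigr => j _; exact: IH.
Qed.

Lemma expectZ k d (c : R) f p :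
  expect k d (fun q => c * f q) p = c * expect k d f p.
Proof.
elim: d k p => [//|d IH] k p /=; rewrite /attach_mean [RHS]mulrCA.
by congr (_ * _); rewrite mulr_sumr; apply: eq_bigr => j _; exact: IH.
Qed.

Lemma expectB k d f g p :
  expect k d (fun q => f q - g q) p = expect k d f p - expect k d g p.
Proof.
rewrite -mulN1r -expectZ -expectD.
by congr expect; apply/funext => q; rewrite mulN1r.
Qed.

Lemma expect_sum k d (I : Type) (r : seq I) (P : pred I)
    (F : I -> (nat -> nat) -> R) p :
  expect k d (fun q => \sum_(i <- r | P i) F i q) p =
  \sum_(i <- r | P i) expect k d (F i) p.
Proof.
elim: r => [|i r IH].
  under eq_fun do rewrite big_nil.
  by rewrite big_nil expect_cst.
under eq_fun do rewrite big_cons.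
by rewrite big_cons; case: ifP => // _; rewrite expectD IH.
Qed.

Lemma expect_ge0 k d f p : parent_map p ->
  (forall q, parent_map q -> 0 <= f q) -> 0 <= expect k d f p.
Proof. by move=> hp f0; rewrite -(expect_cst k d 0 p); exact: expect_le. Qed.

Lemma expect_le_of_attach k d f p j : parent_map p -> (j <= k)%N ->
  (forall q, parent_map q -> 0 <= f q) ->
  k.+1%:R^-1 * expect k.+1 d f (reparent p k.+1 j) <= expect k d.+1 f p.
Proof.
move=> hp jk f0; rewrite /= /attach_mean ler_wpM2l ?invr_ge0 ?ler0n //.
rewrite (bigD1 (Ordinal (jk : (j < k.+1)%N))) //= lerDl.
apply: sumr_ge0 => i _; apply: expect_ge0 => //.
by apply: parent_map_reparent; rewrite // -ltnS.
Qed.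

(** This moves the randomness from graphs to parent maps. Each indicator in [UA] selects one term of
    the sum over [T']. *)
Lemma UA_expect n (f : graph n -> R) :
  \sum_(T : graph n) UA R T * f T =
  expect 0 n (fun p => f (tree_of n p)) (fun=> 0%N).
Proof.
elim: n f => [|n IH] f.
  rewrite /= (bigD1 set0) //= eqxx mul1r big1 ?addr0 // => T.
  by move=> /negPf ->; rewrite mul0r.
transitivity (\sum_(T : graph n) UA R T *
    (n.+1%:R^-1 * \sum_(j < n.+1) f (attach T j))).
  rewrite /=; under eq_bigr do rewrite mulr_suml.
  rewrite exchange_big; apply: eq_bigr => T _ /=.
  under eq_bigr do rewrite -mulrA.
  rewrite -mulr_sumr; congr (_ * _).
  under [LHS]eq_bigr do rewrite mulr_suml.
  rewrite exchange_big mulr_sumr; apply: eq_bigr => j _ /=.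
  rewrite (bigD1 (attach T j)) //= eqxx mulr1 big1 ?addr0 // => T'.
  by move=> /negPf ->; rewrite mulr0 mul0r.
rewrite IH expectSr add0n; apply: eq_expect => // p hp.
rewrite /attach_mean; congr (_ * _); apply: eq_bigr => j _ /=.
rewrite tree_of_reparent //; congr (f (attach _ _)).
by rewrite /reparent eqxx inord_val.
Qed.

(** Where [good] holds, [E] holds for all permutations, so the average over tie-breaks is 1. *)
Lemma UA_prob_ge n (E : graph n -> {perm 'I_n.+1} -> bool)
    (good : (nat -> nat) -> bool) :
  (forall p, parent_map p -> good p -> forall s, E (tree_of n p) s) ->
  expect 0 n (fun p => (good p)%:R) (fun=> 0%N) <= UA_prob R E.
Proof.
move=> goodE; rewrite /UA_prob UA_expect; apply: expect_le => // p hp.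
have [gp|_] := boolP (good p); last first.
  by apply: sumr_ge0 => s _; rewrite mulr_ge0 ?invr_ge0 ?ler0n.
under eq_bigr do rewrite goodE // mulr1.
rewrite sumr_const (card_Sn n.+1) -[leRHS]mulr_natl mulfV //.
by rewrite pnatr_eq0 -lt0n fact_gt0.
Qed.

Lemma sum_subtree k p u :
  \sum_(j < k.+1) (descends p u j)%:R = (subtree_size p k u)%:R :> R.
Proof. by rewrite /subtree_size natr_sum. Qed.

(* Expectation of g(S) where S is the number of white balls after d draws from
   a Polya urn that starts with a white balls among j. *)
Fixpoint urn (g : nat -> R) d a j : R :=
  if d is d'.+1 then a%:R / j%:R * urn g d' a.+1 j.+1
                     + (1 - a%:R / j%:R) * urn g d' a j.+1
  else g a.

(** A new vertex joins the subtree of [u] with probability proportional to its current size: the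
    descendants of [u] are the white balls. *)
Lemma expect_subtree_add (g : nat -> R) u k d p : parent_map p -> (u <= k)%N ->
  expect k d (fun q => g (subtree_size q (k + d) u)) p =
  urn g d (subtree_size p k u) k.+1.
Proof.
elim: d k p => [|d IH] k p hp uk; first by rewrite /= addn0.
rewrite -addSnnS /= /attach_mean.
set A := urn g d _.+1 _; set B := urn g d _ _.
rewrite (eq_bigr (fun j : 'I_k.+1 => B + (descends p u j)%:R * (A - B))).
  rewrite big_split /= sumr_const card_ord -[B *+ _]mulr_natl -mulr_suml.
  rewrite sum_subtree; have : k.+1%:R != 0 :> R by rewrite pnatr_eq0.
  by move: (k.+1%:R) => K K0; field.
move=> j _; have jk : (j <= k)%N by rewrite -ltnS.
rewrite IH; [|exact: parent_map_reparent|lia].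
rewrite subtree_size_reparent //.
by case: descends; rewrite ?addn1 ?addn0 ?mul1r ?mul0r ?addr0 // addrC subrK.
Qed.

Lemma expect_subtree (g : nat -> R) u k n p :
  parent_map p -> (u <= k)%N -> (k <= n)%N ->
  expect k (n - k) (fun q => g (subtree_size q n u)) p =
  urn g (n - k) (subtree_size p k u) k.+1.
Proof.
move=> hp uk kn; have := expect_subtree_add g (n - k) hp uk.
by rewrite subnKC.
Qed.

End Process.

(** * The Polya urn: monotonicity, colour swap, lower tail *)

Section Urn.
Variable R : realType.
Implicit Types g h : nat -> R.

Lemma urn_le g h d a j : (a <= j)%N -> (0 < j)%N -> (forall i, g i <= h i) ->
  urn g d a j <= urn h d a j.
Proof.
move=> aj j0 gh; elim: d a j aj j0 => [|d IH] a j aj j0 //=.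
have r1 : a%:R / j%:R <= 1 :> R by rewrite ler_pdivrMr ?ltr0n // mul1r ler_nat.
have r0 : 0 <= a%:R / j%:R :> R by rewrite divr_ge0.
by apply: lerD; apply: ler_wpM2l; rewrite ?subr_ge0 //; apply: IH; lia.
Qed.

Lemma urnSr g d a j :
  urn g d.+1 a j = urn (fun S => S%:R / (j + d)%:R * g S.+1
                              + (1 - S%:R / (j + d)%:R) * g S) d a j.
Proof.
elim: d a j => [|d IH] a j; first by rewrite /= addn0.
by rewrite [LHS]/= -/(urn g d.+1 a.+1 j.+1) -/(urn g d.+1 a j.+1) !IH /= addSnnS.
Qed.

Lemma urnD g h d a j : urn (fun S => g S + h S) d a j = urn g d a j + urn h d a j.
Proof. by elim: d a j => [//|d IH] a j /=; rewrite !IH; ring. Qed.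

Lemma urnZ c g d a j : urn (fun S => c * g S) d a j = c * urn g d a j.
Proof. by elim: d a j => [//|d IH] a j /=; rewrite !IH; ring. Qed.

Lemma urn_ge0 g d a j : (a <= j)%N -> (0 < j)%N -> (forall i, 0 <= g i) ->
  0 <= urn g d a j.
Proof.
move=> aj j0 g0; rewrite -[leLHS](mul0r (urn (fun=> 0) d a j)) -urnZ.
by apply: urn_le => // i; rewrite mul0r.
Qed.

(** The number of white balls never decreases. *)
Lemma urn_leS g d a j : (a <= j)%N -> (0 < j)%N ->
  (forall i, g i <= g i.+1) -> urn g d a j <= urn g d.+1 a j.
Proof.
move=> aj j0 gS; rewrite urnSr; apply: urn_le => // S.
rewrite mulrBl mul1r addrCA lerDl -mulrBr mulr_ge0 ?divr_ge0 //.
by rewrite subr_ge0.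
Qed.

(** The balls of the other colour also follow a Polya urn. *)
Lemma urn_compl g d a j : (a <= j)%N -> (0 < j)%N ->
  urn g d a j = urn (fun b => g (j + d - b)%N) d (j - a) j.
Proof.
elim: d a j => [|d IH] a j aj j0 /=; first by rewrite addn0 subKn.
have e : (j - a)%N%:R / j%:R = 1 - a%:R / j%:R :> R.
  by rewrite natrB // mulrBl divff // pnatr_eq0 -lt0n.
rewrite e subKr -subSn // -addSnnS -IH //; last lia.
by rewrite (IH a.+1 j.+1) // subSS addrC.
Qed.

(* (j - 1) / (a - 1) is a martingale of the urn. *)
Lemma urn_inv g d a j : (1 < a)%N -> (a <= j)%N ->
  (forall S, (1 < S)%N -> g S = S.-1%:R^-1) ->
  urn g d a j = j.-1%:R / (a.-1%:R * (j + d).-1%:R).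
Proof.
move=> a1 aj gE; elim: d a j a1 aj => [|d IH] a j a1 aj.
  rewrite /= addn0 gE // invfM mulrCA divff ?mulr1 // pnatr_eq0; lia.
rewrite /= !IH //; try lia.
rewrite addSnnS; have N0 : (j + d.+1).-1%:R != 0 :> R by rewrite pnatr_eq0; lia.
have a0 : a%:R != 0 :> R by rewrite pnatr_eq0; lia.
have a10 : a.-1%:R != 0 :> R by rewrite pnatr_eq0; lia.
have j0 : j%:R != 0 :> R by rewrite pnatr_eq0; lia.
have aE : a%:R = a.-1%:R + 1 :> R by rewrite natr1 prednK; [|lia].
have jE : j%:R = j.-1%:R + 1 :> R by rewrite natr1 prednK; [|lia].
by move: a0 j0; rewrite aE jE => a0 j0; field; rewrite N0 a10 a0 j0.
Qed.

(** Markov's inequality for 1/(S - 1), whose mean is given by [urn_inv]. *)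
Lemma urn_lower_tail s d a j : (0 < s)%N -> (1 < a)%N -> (a <= j)%N ->
  urn (fun S => (S <= s)%N%:R) d a j <=
  s%:R * j.-1%:R / (a.-1%:R * (j + d).-1%:R) :> R.
Proof.
(* The value 1 replaces the default 1/0 = 0 at S <= 1, so that s g(S) dominates the indicator for
   every S. *)
move=> s0 a1 aj; pose g S : R := if (1 < S)%N then S.-1%:R^-1 else 1.
have gE S : (1 < S)%N -> g S = S.-1%:R^-1 by rewrite /g => ->.
rewrite -mulrA -(urn_inv d a1 aj gE) -urnZ; apply: urn_le => //; first lia.
move=> S; have s1 : 1 <= s%:R :> R by rewrite ler1n.
rewrite /g; case: (ltnP 1 S) => S1; last by rewrite mulr1; case: leqP => //; lra.
have S0 : 0 < S.-1%:R :> R by rewrite ltr0n; lia.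
rewrite ler_pdivlMr //; case: leqP => Ss; rewrite ?mul0r ?mul1r ?ler_nat //; lia.
Qed.

End Urn.

(** * Tails of subtree sizes, for one vertex and for pairs *)

Section Tails.
Variable R : realType.
Implicit Types (p : nat -> nat).

(* P(vertex v of T_n has more than s descendants); a new vertex v is the single
   white ball among v + 1. *)
Definition tail (s n v : nat) : R :=
  urn (fun S => (s < S)%N%:R) (n - v) 1 v.+1.

(** Conditioning on the last draw gives P_{n+1}(s) = (1 - s/(n+1)) P_n(s) + s/(n+1) P_n(s-1), and
    the binomial quotient obeys the same recursion. *)
Lemma tailE s n v : (0 < v)%N -> (v <= n)%N ->
  tail s n v = 'C(n - s, v)%:R / 'C(n, v)%:R.
Proof.
move=> v0 /subnKC <-; move: (n - v)%N => d {n}.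
elim: d s => [|d IH] s.
  rewrite /tail addn0 subnn binn divr1 /=; congr _%:R.
  by case: s => [|s]; rewrite ?subn0 ?binn // bin_small //; lia.
have tE t e : tail t (v + e) v = urn (fun S => (t < S)%N%:R) e 1 v.+1.
  by rewrite /tail addKn.
set n := (v + d)%N in IH *; have nE : (v.+1 + d = n.+1)%N by rewrite addSn.
rewrite tE urnSr nE.
(* Both sides equal the indicator of s < S except at S = s, where both are s/(n+1). *)
have -> : (fun S : nat => S%:R / n.+1%:R * (s < S.+1)%N%:R
      + (1 - S%:R / n.+1%:R) * (s < S)%N%:R) =
    (fun S => (1 - s%:R / n.+1%:R) * (s < S)%N%:R
      + s%:R / n.+1%:R * (s.-1 < S)%N%:R) :> (nat -> R).
  apply/funext => S; case: (ltngtP s S) => sS.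
  - by rewrite ltnS (ltnW sS) (_ : (s.-1 < S)%N); [ring|lia].
  - rewrite ltnS leqNgt sS /= !mulr0 !add0r.
    have [->|s0] := posnP s; first by rewrite !mul0r.
    by rewrite (_ : (s.-1 < S)%N = false) ?mulr0 //; lia.
  - rewrite sS ltnSn ?ltnn /= !mulr0 addr0 add0r.
    have [->|S0] := posnP S; first by rewrite !mul0r.
    by rewrite (_ : (S.-1 < S)%N) //; lia.
rewrite urnD !urnZ -!tE -/n !IH addnS -/n.
have Cn0 : 'C(n, v)%:R != 0 :> R by rewrite pnatr_eq0 -lt0n bin_gt0 leq_addr.
have CS0 : 'C(n.+1, v)%:R != 0 :> R.
  by rewrite pnatr_eq0 -lt0n bin_gt0 ltnW // ltnS leq_addr.
have n0 : n.+1%:R != 0 :> R by rewrite pnatr_eq0.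
have E1 : n.+1%:R * 'C(n, v)%:R = (n.+1%:R - v%:R) * 'C(n.+1, v)%:R :> R.
  rewrite -natrM (mul_bin_down n.+1 v) natrM natrB //.
  by rewrite (leq_trans (leq_addr d v)).
have [sn|ns] := leqP s n; last first.
  have -> : (n.+1 - s = 0)%N by lia.
  have -> : (n - s = 0)%N by lia.
  have -> : (n - s.-1 = 0)%N by lia.
  by rewrite bin0n gtn_eqF // !mul0r !mulr0 addr0.
have rE : (n - s.-1 = if s is 0 then n else (n - s).+1)%N by case: s {IH tE} sn => //; lia.
have E2 : (n - s).+1%:R * 'C(n - s, v)%:R =
          ((n - s).+1%:R - v%:R) * 'C((n - s).+1, v)%:R :> R.
  rewrite -natrM (mul_bin_down (n - s).+1 v) natrM.
  have [vr|rv] := leqP v (n - s).+1; first by rewrite natrB.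
  by rewrite bin_small // !mulr0.
have nv0 : n.+1%:R - v%:R != 0 :> R.
  by rewrite -natrB ?pnatr_eq0 /n; [|lia]; lia.
(* At s = 0 the truncated [s.-1] breaks [n - s.-1 = (n - s).+1], but the coefficient vanishes. *)
have -> : s%:R / n.+1%:R * ('C(n - s.-1, v)%:R / 'C(n, v)%:R) =
    s%:R / n.+1%:R * ('C((n - s).+1, v)%:R / 'C(n, v)%:R) :> R.
  by rewrite rE; case: s {IH tE sn rE E2} => //; rewrite !mul0r.
rewrite subSn //.
apply: (mulfI n0); apply: (mulIf Cn0).
transitivity (((n.+1%:R - s%:R) * 'C(n - s, v)%:R + s%:R * 'C((n - s).+1, v)%:R) : R).
  by move: (n.+1%:R) n0 => N N0; field; rewrite Cn0 N0.
have -> : n.+1%:R - s%:R = (n - s).+1%:R :> R by rewrite -subSn // natrB //; lia.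
rewrite E2 -mulrDl.
have -> : (n - s).+1%:R - v%:R + s%:R = n.+1%:R - v%:R :> R.
  by rewrite -subSn // natrB; [ring|lia].
rewrite [RHS]mulrAC E1 -[RHS]mulrA; congr (_ * _).
by rewrite [RHS]mulrC divfK.
Qed.

(** As long as s + v <= n the ratio is 1 - s/(n - v). Comparing it with 1 - s/n and, for v <= K,
    with 1 - s/(n - K) gives the two geometric bounds that follow. *)
Lemma tailS s n v : (0 < v)%N -> (v < n)%N ->
  tail s n v.+1 = tail s n v * ((n - s - v)%N%:R / (n - v)%N%:R).
Proof.
move=> v0 vn; rewrite !tailE ?(ltnW vn) //.
have v10 : v.+1%:R != 0 :> R by rewrite pnatr_eq0.
have C0 : 'C(n, v)%:R != 0 :> R by rewrite pnatr_eq0 -lt0n bin_gt0 ltnW.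
have C1 : 'C(n, v.+1)%:R != 0 :> R by rewrite pnatr_eq0 -lt0n bin_gt0.
have nv : (n - v)%N%:R != 0 :> R by rewrite pnatr_eq0 -lt0n subn_gt0.
have E1 : v.+1%:R * 'C(n, v.+1)%:R = (n - v)%N%:R * 'C(n, v)%:R :> R.
  by rewrite -!natrM mul_bin_left.
have E2 : v.+1%:R * 'C(n - s, v.+1)%:R = (n - s - v)%N%:R * 'C(n - s, v)%:R :> R.
  by rewrite -!natrM mul_bin_left.
apply: (mulIf C1); rewrite divfK //; apply: (mulfI v10); rewrite E2.
rewrite [RHS]mulrCA E1; field; by rewrite C0 nv.
Qed.

Lemma tail1 s n : (0 < n)%N -> tail s n 1 = (n - s)%N%:R / n%:R.
Proof. by move=> n0; rewrite tailE // !bin1. Qed.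

Lemma tail_ge0 s n v : 0 <= tail s n v.
Proof. by apply: urn_ge0. Qed.

Lemma tail_le s n v : (s <= n)%N -> (0 < v)%N -> (v <= n)%N ->
  tail s n v <= (1 - s%:R / n%:R) ^+ v.
Proof.
move=> sn; case: v => // v _; elim: v => [|v IH] vn.
  rewrite tail1 // natrB // mulrBl divff ?pnatr_eq0; [by []|lia].
have n0 : 0 < n%:R :> R by rewrite ltr0n; lia.
rewrite tailS // exprSr; apply: ler_pM; rewrite ?tail_ge0 ?divr_ge0 //.
  by apply: IH; lia.
have nv0 : 0 < (n - v.+1)%N%:R :> R by rewrite ltr0n; lia.
have x1 : s%:R / n%:R <= 1 :> R by rewrite ler_pdivrMr // mul1r ler_nat.
rewrite ler_pdivrMr //; case: (leqP v.+1 (n - s)) => h; last first.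
  by rewrite (_ : (n - s - v.+1 = 0)%N); [apply: mulr_ge0; lra|lia].
rewrite !natrB //; try lia.
have -> : (1 - s%:R / n%:R) * (n%:R - v.+1%:R) =
  n%:R - s%:R - v.+1%:R + (s%:R / n%:R) * v.+1%:R :> R.
  by field; rewrite gt_eqF.
by rewrite lerDl mulr_ge0 // divr_ge0.
Qed.

Lemma tail_ge s n K v : (s + K <= n)%N -> (K < n)%N -> (0 < v)%N -> (v <= K)%N ->
  (1 - s%:R / (n - K)%N%:R) ^+ v <= tail s n v.
Proof.
move=> sKn Kn; case: v => // v _.
have nK0 : 0 < (n - K)%N%:R :> R by rewrite ltr0n; lia.
have x1 : s%:R / (n - K)%N%:R <= 1 :> R.
  by rewrite ler_pdivrMr // mul1r ler_nat; lia.
have step i : (i <= K)%N ->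
    1 - s%:R / (n - K)%N%:R <= (n - s - i)%N%:R / (n - i)%N%:R :> R.
  move=> iK; have ni0 : 0 < (n - i)%N%:R :> R by rewrite ltr0n; lia.
  rewrite ler_pdivlMr // mulrBl mul1r subnAC [leRHS]natrB; last lia.
  rewrite lerD2l lerN2 [leRHS]mulrAC ler_pdivlMr // ler_wpM2l // ler_nat; lia.
elim: v => [|v IH] vK.
  by have := step 0%N isT; rewrite !subn0 tail1 //; lia.
rewrite tailS //; try lia.
rewrite exprSr; apply: ler_pM; rewrite ?exprn_ge0 ?subr_ge0 //.
  by apply: IH; lia.
by apply: step; lia.
Qed.

Lemma subtree_disjoint p n u v : parent_map p -> (u < v)%N ->
  ~~ descends p u v -> (subtree_size p n u + subtree_size p n v <= n.+1)%N.
Proof.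
move=> hp uv huv; rewrite /subtree_size -big_split /=.
rewrite -[n.+1 in leqRHS]card_ord -sum1_card; apply: leq_sum => i _.
have := @descends_comparable p hp u v i.
case: (descends p u i); case: (descends p v i) => //= /(_ isT isT (ltnW uv)).
by move=> e; rewrite e in huv.
Qed.

(* A three-colour urn: removing all draws of the second colour leaves an urn in
   which the first colour does at least as well, independently of the second. *)
Lemma expect_pair_le (s k d u v : nat) p : parent_map p ->
  (u < v)%N -> (v <= k)%N -> ~~ descends p u v ->
  expect k d (fun q => (s < subtree_size q (k + d) u)%N%:R
                       * (s < subtree_size q (k + d) v)%N%:R) p
  <= urn (fun S => (s < S)%N%:R) d (subtree_size p k u) (k.+1 - subtree_size p k v)
     * urn (fun S => (s < S)%N%:R) d (subtree_size p k v) k.+1 :> R.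
Proof.
move=> hp uv vk huv; set I : nat -> R := fun S => (s < S)%N%:R.
have IS i : I i <= I i.+1 by rewrite /I ler_nat; lia.
have I0 i : 0 <= I i by rewrite ler0n.
elim: d k p hp vk huv => [|d IH] k p hp vk huv; first by rewrite /= addn0.
set a := subtree_size p k u; set b := subtree_size p k v.
have ab : (a + b <= k.+1)%N by exact: subtree_disjoint.
have a0 : (0 < a)%N.
  rewrite /a /subtree_size (bigD1 (Ordinal (leq_ltn_trans (ltnW uv) (vk : v < k.+1)%N))) //=.
  by rewrite descends_refl.
(* Induction bounds when the next vertex lands below [u] ([X1]), below [v] ([X2]) or elsewhere
   ([X3]). In [X2] the reduced urn keeps its state, since [k.+2 - b.+1] is [k.+1 - b]. *)
pose X3 := urn I d a (k.+2 - b) * urn I d b k.+2.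
pose X1 := urn I d a.+1 (k.+2 - b) * urn I d b k.+2.
pose X2 := urn I d a (k.+1 - b) * urn I d b.+1 k.+2.
apply: (@le_trans _ _ (k.+1%:R^-1 * \sum_(j < k.+1)
    (X3 + (descends p u j)%:R * (X1 - X3) + (descends p v j)%:R * (X2 - X3)))).
  rewrite -addSnnS /= ler_wpM2l ?invr_ge0 ?ler0n //; apply: ler_sum => j _.
  have jk : (j <= k)%N by rewrite -ltnS.
  apply: le_trans (IH _ _ _ _ _) _; first exact: parent_map_reparent.
  - lia.
  - by rewrite descends_reparent.
  rewrite !subtree_size_reparent //; last lia.
  rewrite -/a -/b; have := @descends_comparable p hp u v j.
  case: (descends p u j); case: (descends p v j) => /=.
  - by move=> /(_ isT isT (ltnW uv)) e; rewrite e in huv.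
  - by rewrite mul1r mul0r addr0 addrC subrK addn0 addn1.
  - by rewrite mul1r mul0r addr0 addrC subrK addn0 addn1 subSS.
  - by rewrite !mul0r !addr0 !addn0.
rewrite !big_split [in leLHS]/= sumr_const card_ord.
rewrite -!mulr_suml !sum_subtree -/a -/b -[X3 *+ _]mulr_natl.
have bk : (b <= k.+1)%N by exact: leq_trans (leq_addl a b) ab.
have k0 : 0 < k.+1%:R :> R by rewrite ltr0n.
have kb0 : 0 < (k.+1 - b)%N%:R :> R by rewrite ltr0n; lia.
have urnE : urn I d.+1 a (k.+1 - b) = a%:R / (k.+1 - b)%N%:R * urn I d a.+1 (k.+2 - b)
    + (1 - a%:R / (k.+1 - b)%N%:R) * urn I d a (k.+2 - b).
  by rewrite [X in urn _ _ a.+1 X]subSn // [X in (1 - _) * urn _ _ a X]subSn.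
(* An attachment below [v] spends a step without advancing the reduced urn; granting that urn one
   more draw only raises its tail. *)
have mono : urn I d a (k.+1 - b) <= urn I d.+1 a (k.+1 - b).
  by apply: urn_leS => //; lia.
have -> : k.+1%:R^-1 * (k.+1%:R * X3 + a%:R * (X1 - X3) + b%:R * (X2 - X3)) =
  (1 - b%:R / k.+1%:R) * urn I d b k.+2 * urn I d.+1 a (k.+1 - b)
   + b%:R / k.+1%:R * urn I d b.+1 k.+2 * urn I d a (k.+1 - b).
  rewrite urnE /X1 /X2 /X3; move: kb0; rewrite natrB //.
  move: (k.+1%:R) k0 => N N0 kb0; field.
  by rewrite !gt_eqF.
set b1 := urn I d b.+1 k.+2; set b0 := urn I d b k.+2.
have -> : urn I d.+1 b k.+1 = b%:R / k.+1%:R * b1 + (1 - b%:R / k.+1%:R) * b0 by [].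
rewrite [leRHS]mulrC [leRHS]mulrDl [leRHS]addrC lerD2l ler_wpM2l //.
by rewrite mulr_ge0 ?divr_ge0 //; apply: urn_ge0 => //; lia.
Qed.

Lemma urn_id d a j : (0 < j)%N ->
  urn (fun S => S%:R) d a j = a%:R * (j + d)%:R / j%:R :> R.
Proof.
elim: d a j => [|d IH] a j j0.
  by rewrite /= addn0 mulfK // pnatr_eq0; lia.
rewrite /= !IH // addSnnS -!natr1; field.
by rewrite natr1 !pnatr_eq0; lia.
Qed.

(** Whatever the earlier tree and the parent chosen, [v] arrives with itself as its only
    descendant. *)
Lemma expect_tail_from s k n v p : parent_map p -> (k < v)%N -> (v <= n)%N ->
  expect k (n - k) (fun q => (s < subtree_size q n v)%N%:R) p = tail s n v.
Proof.
case: v => // v hp kv vn.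
rewrite (_ : n - k = (v - k) + (n - v))%N; last lia.
rewrite expect_add subnKC // -[RHS](expect_cst k (v - k) _ p).
apply: eq_expect => // q hq.
rewrite (_ : n - v = (n - v.+1).+1)%N; last lia.
rewrite /= /attach_mean (eq_bigr (fun=> tail s n v.+1)).
  by rewrite sumr_const card_ord -[tail _ _ _ *+ _]mulr_natl mulKf // pnatr_eq0.
move=> j _; have jv : (j <= v)%N by rewrite -ltnS.
rewrite (expect_subtree (fun S => (s < S)%N%:R)) //; last exact: parent_map_reparent.
by rewrite subtree_size_reparent_new.
Qed.

Lemma expect_tail s n v p : parent_map p -> (0 < v)%N -> (v <= n)%N ->
  expect 0 n (fun q => (s < subtree_size q n v)%N%:R) p = tail s n v.
Proof.
by move=> hp v0 vn; rewrite -(expect_tail_from s hp v0 vn) subn0.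
Qed.

(** Condition on the tree just before [v] arrives. If the parent of [v] does not descend from [u],
    [expect_pair_le] applies; otherwise the product is at most the indicator for [v]. The extra term
    is the probability 1/(u+1) that [v] descends from [u]. *)
Lemma expect_tail_pair s n u v p : parent_map p ->
  (0 < u)%N -> (u < v)%N -> (v <= n)%N ->
  expect 0 n (fun q => (s < subtree_size q n u)%N%:R
                       * (s < subtree_size q n v)%N%:R) p
  <= tail s n v * (tail s n u + u.+1%:R^-1).
Proof.
case: v => // v hp u0 uv vn; have nE : (v + (n - v) = n)%N by lia.
pose I S : R := (s < S)%N%:R.
have I0 i : 0 <= I i by rewrite ler0n.
have uv' : (u <= v)%N by lia.
rewrite -{1}nE expect_add add0n.
have step q : parent_map q ->
  expect v (n - v) (fun q => I (subtree_size q n u) * I (subtree_size q n v.+1)) q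
  <= tail s n v.+1 * (urn I (n - v.+1) (subtree_size q v u) v.+1
                      + v.+1%:R^-1 * (subtree_size q v u)%:R).
  move=> hq; rewrite (_ : n - v = (n - v.+1).+1)%N; last lia.
  set F := urn I _ _ _.
  have F0 : 0 <= F by apply: urn_ge0 => //; exact: subtree_size_le.
  rewrite /= /attach_mean.
  apply: (@le_trans _ _ (v.+1%:R^-1 * \sum_(j < v.+1)
      (tail s n v.+1 * (F + (descends q u j)%:R)))); last first.
    rewrite -mulr_sumr big_split /= sum_subtree sumr_const card_ord.
    rewrite -[F *+ _]mulr_natl mulrCA mulrDr mulKf //.
    by rewrite pnatr_eq0.
  rewrite ler_wpM2l ?invr_ge0 ?ler0n //; apply: ler_sum => j _.
  have jv : (j <= v)%N by rewrite -ltnS.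
  have hq' := parent_map_reparent hq jv.
  have duv : descends (reparent q v.+1 j) u v.+1 = descends q u j.
    exact: descends_reparent_new.
  have tE : tail s n v.+1 = expect v.+1 (n - v.+1)
      (fun q => I (subtree_size q n v.+1)) (reparent q v.+1 j).
    by rewrite expect_subtree // subtree_size_reparent_new.
  have [hd|hd] := boolP (descends q u j).
    apply: (@le_trans _ _ (tail s n v.+1)); last first.
      by rewrite ler_peMr ?tail_ge0 // lerDr.
    rewrite tE; apply: expect_le => // q' _.
    by rewrite ler_piMl // /I lern1; case: (s < _)%N.
  have := expect_pair_le s (n - v.+1) hq' uv (leqnn v.+1).
  rewrite duv subnKC // addr0 => /(_ hd) /le_trans; apply.
  rewrite subtree_size_reparent_new // subtree_size_reparent // (negPf hd) addn0.
  by rewrite subSS subn0 mulrC.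
apply: le_trans (expect_le _ _ hp step) _.
rewrite expectZ ler_wpM2l ?tail_ge0 // expectD; apply: lerD; last first.
  rewrite expectZ.
  (* The fraction of vertices below [u] is a martingale, equal to 1/(u+1) when [u] arrives. *)
  have -> : expect 0 v (fun q => (subtree_size q v u)%:R) p = v.+1%:R / u.+1%:R :> R.
    case: u u0 uv uv' {step} => // u _ uv uv'.
    have vE : (u + (v - u) = v)%N by lia.
    rewrite -{1}vE expect_add add0n -[RHS](expect_cst 0 u _ p).
    apply: eq_expect => // q hq.
    rewrite (_ : v - u = (v - u.+1).+1)%N; last lia.
    rewrite /= /attach_mean (eq_bigr (fun=> v.+1%:R / u.+2%:R)).
      by rewrite sumr_const card_ord -[_ / _ *+ _]mulr_natl mulKf // pnatr_eq0.
    move=> j _; have ju : (j <= u)%N by rewrite -ltnS.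
    rewrite (expect_subtree (fun S => S%:R)) //; last exact: parent_map_reparent.
    by rewrite subtree_size_reparent_new // urn_id // mul1r addSn subnKC.
  by rewrite mulKf // pnatr_eq0.
(* The reduced urn has the law of the subtree of [u] in a tree with one vertex less, so its tail is
   at most [tail s n u]. *)
have hI q : parent_map q -> urn I (n - v.+1) (subtree_size q v u) v.+1 =
    expect v (n - v.+1) (fun q => I (subtree_size q n.-1 u)) q.
  move=> hq; rewrite (_ : n - v.+1 = n.-1 - v)%N; last lia.
  by rewrite expect_subtree //; lia.
rewrite (eq_expect _ _ hp hI) -{1}[v]add0n -expect_add.
rewrite (_ : v + (n - v.+1) = n.-1)%N; last lia.
rewrite (expect_tail s) //; last lia.
rewrite /tail (_ : n - u = (n.-1 - u).+1)%N; last lia.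
by apply: urn_leS => // i; rewrite ler_nat; lia.
Qed.

End Tails.

(** * Counting large subtrees *)

(** The root is left out, since its subtree is the whole tree; it accounts for the [.+1] after
    [big_count] below. *)
Definition big_count (s n B : nat) (p : nat -> nat) : nat :=
  \sum_(v < B) (s < subtree_size p n v.+1)%N.

Lemma card_big_subtrees s n p : parent_map p -> (s <= n)%N ->
  #|[set v : 'I_n.+1 | (s < subtree_size p n v)%N]| = (big_count s n n p).+1.
Proof.
move=> hp sn; rewrite -sum1_card big_mkcond big_ord_recl /= inE.
rewrite subtree_size0 // ltnS sn add1n; congr _.+1.
by apply: eq_bigr => v _; rewrite inE lift0; case: ltnP.
Qed.

Lemma card_big_subtrees_old s n K p : parent_map p -> (s <= n)%N ->
  (0 < K)%N -> (K <= n)%N ->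
  #|[set v : 'I_n.+1 | (s < subtree_size p n v)%N]
    :&: [set v : 'I_n.+1 | (v < K)%N]| = (big_count s n K.-1 p).+1.
Proof.
move=> hp sn; case: K => // K _ Kn.
rewrite -sum1_card /big_count /=.
transitivity (\sum_(v < n.+1 | (v < K.+1)%N) (s < subtree_size p n v)%N)%N.
  rewrite big_mkcond [RHS]big_mkcond; apply: eq_bigr => v _ /=.
  by rewrite !inE; case: (s < _)%N; case: (v < _)%N.
rewrite (big_ord_narrow (leqW Kn)) /= big_ord_recl /= subtree_size0 //.
by rewrite ltnS sn add1n.
Qed.

(** * Second moment of the number of large subtrees *)

Section Variance.
Variable R : realType.

Local Notation E n f := (expect 0 n f (fun=> 0%N)).

(** [big_subtrees_most_central] with m = s + 1, for which [n.+1 - m] is [n - s]. *)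
Lemma UA_prob_overlap_ge n s k K (r : R) : (s <= n)%N -> (0 < K)%N -> (K <= n)%N ->
  E n (fun q => [&& ((big_count s n n q).+1 <= k)%N,
      [forall w : 'I_n, (subtree_size q n w.+1 <= n - s)%N]
      & r <= (big_count s n K.-1 q).+1%:R]%:R)
  <= UA_prob R (fun (T : graph n) perm =>
       r <= #|most_central T perm k :&: [set v : 'I_n.+1 | (v < K)%N]|%:R).
Proof.
move=> sn K0 Kn; apply: UA_prob_ge => p hp /and3P[hk hw hr] perm.
apply: le_trans hr _; rewrite ler_nat -card_big_subtrees_old //.
apply/subset_leq_card/setSI/big_subtrees_most_central => //.
  by rewrite card_big_subtrees.
move=> w w0; have wn : (w.-1 < n)%N by have := ltn_ord w; lia.
by have := forallP hw (Ordinal wn); rewrite /= prednK // subSS.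
Qed.

Definition mean_count s n B : R := \sum_(v < B) tail R s n v.+1.

(** By [expect_tail_pair] the covariance for a pair u < v is at most [tail s n v] / (u+1). The index
    [u] stands for vertex u + 1, hence [u.+2]. *)
Definition variance_bound s n B : R :=
  \sum_(v < B) tail R s n v.+1 * (1 + 2 * \sum_(u < v) u.+2%:R^-1).

Lemma big_countS s n B q :
  big_count s n B.+1 q = (big_count s n B q + (s < subtree_size q n B.+1))%N.
Proof. by rewrite /big_count big_ord_recr. Qed.

Lemma expect_count s n B : (B <= n)%N ->
  E n (fun q => (big_count s n B q)%:R) = mean_count s n B.
Proof.
move=> Bn; rewrite /mean_count.
under eq_fun do rewrite /big_count natr_sum.
rewrite expect_sum; apply: eq_bigr => v _.
by apply: expect_tail => //; have := ltn_ord v; lia.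
Qed.

Lemma expect_count_sqr s n B : (B <= n)%N ->
  E n (fun q => (big_count s n B q)%:R ^+ 2)
  <= mean_count s n B ^+ 2 + variance_bound s n B.
Proof.
elim: B => [|B IH] Bn.
  rewrite /mean_count /variance_bound !big_ord0 expr0n addr0.
  by rewrite (eq_expect _ _ _ (g := fun=> 0)) ?expect_cst // => q _;
    rewrite /big_count big_ord0 expr0n.
pose I q : R := (s < subtree_size q n B.+1)%N%:R.
have EI : E n I = tail R s n B.+1 by exact: expect_tail.
have cross : E n (fun q => (big_count s n B q)%:R * I q)
    <= tail R s n B.+1 * (mean_count s n B + \sum_(u < B) u.+2%:R^-1).
  under eq_fun do rewrite /big_count natr_sum mulr_suml.
  rewrite expect_sum /mean_count -big_split mulr_sumr; apply: ler_sum => u _ /=.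
  by apply: expect_tail_pair => //; have := ltn_ord u; lia.
rewrite (eq_expect _ _ _ (g := fun q => (big_count s n B q)%:R ^+ 2
    + (2 * ((big_count s n B q)%:R * I q) + I q))) //; last first.
  move=> q _; rewrite big_countS natrD sqrrD -addrA; congr (_ + (_ + _)).
    by rewrite mulr_natl.
  by rewrite /I; case: (s < _)%N; rewrite ?expr0n ?expr1n.
rewrite !expectD expectZ EI /mean_count /variance_bound !big_ord_recr /=.
have := IH (ltnW Bn); rewrite -/(mean_count s n B) -/(variance_bound s n B).
move: cross; set S2 := E n _; set S1 := E n _.
have := sqr_ge0 (tail R s n B.+1).
set t := tail _ _ _ _; set mu := mean_count _ _ _; set V := variance_bound _ _ _.
set h := \sum_(u < B) _; rewrite /S1 /S2; nra.
Qed.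

(** The event [f] is left free so that one-sided deviations of either sign fit. *)
Lemma chebyshev_count s n B (tau : R) (f : (nat -> nat) -> bool) :
  (B <= n)%N -> 0 < tau ->
  (forall q, f q -> tau ^+ 2 <= ((big_count s n B q)%:R - mean_count s n B) ^+ 2) ->
  E n (fun q => (f q)%:R) <= variance_bound s n B / tau ^+ 2.
Proof.
move=> Bn tau0 hf; set mu := mean_count s n B.
have t2 : 0 < tau ^+ 2 by rewrite exprn_gt0.
rewrite ler_pdivlMr //.
have := expect_count_sqr s Bn; rewrite -/mu => h.
apply: (@le_trans _ _ (E n (fun q => (big_count s n B q)%:R ^+ 2
    + ((- 2 * mu) * (big_count s n B q)%:R + mu ^+ 2)))); last first.
  by rewrite !expectD expectZ expect_cst expect_count // -/mu; lra.
rewrite mulrC -expectZ; apply: expect_le => // q _.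
have -> : (big_count s n B q)%:R ^+ 2
    + ((- 2 * mu) * (big_count s n B q)%:R + mu ^+ 2)
    = ((big_count s n B q)%:R - mu) ^+ 2 by ring.
case fq : (f q); first by rewrite mulr1; exact: hf.
by rewrite mulr0 sqr_ge0.
Qed.

Lemma sum_geometric_le (y : R) B : 0 <= y -> y < 1 ->
  \sum_(v < B) y ^+ v.+1 <= y / (1 - y).
Proof.
move=> y0 y1; have x0 : 0 < 1 - y by lra.
rewrite ler_pdivlMr //.
suff -> : (\sum_(v < B) y ^+ v.+1) * (1 - y) = y - y ^+ B.+1.
  by rewrite lerBlDr lerDl exprn_ge0.
elim: B => [|B IH]; first by rewrite big_ord0 mul0r expr1 subrr.
by rewrite big_ord_recr /= mulrDl IH !exprS; ring.
Qed.

Lemma sum_arith_geometric_le (y : R) B : 0 <= y -> y < 1 ->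
  \sum_(v < B) v%:R * y ^+ v.+1 <= (1 - y) ^- 2.
Proof.
move=> y0 y1; have x0 : 0 < 1 - y by lra.
rewrite -[leRHS]mul1r ler_pdivlMr ?exprn_gt0 //.
(* The remainder term on the right makes the induction on [B] close. *)
suff : (\sum_(v < B) v%:R * y ^+ v.+1) * (1 - y) ^+ 2
       <= 1 - y ^+ B * (1 + B%:R * (1 - y)).
  move=> /le_trans; apply; rewrite gerBl mulr_ge0 ?exprn_ge0 //.
  by rewrite addr_ge0 // mulr_ge0 // ltW.
elim: B => [|B IH]; first by rewrite big_ord0 mul0r expr0; lra.
rewrite big_ord_recr /= mulrDl; apply: le_trans (lerD IH (lexx _)) _.
have yB : 0 <= y ^+ B by rewrite exprn_ge0.
have B0 : 0 <= B%:R :> R by [].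
rewrite exprS -natr1 -subr_ge0.
have -> : 1 - y * y ^+ B * (1 + (B%:R + 1) * (1 - y)) -
    (1 - y ^+ B * (1 + B%:R * (1 - y)) + B%:R * (y * y ^+ B) * (1 - y) ^+ 2)
  = y ^+ B * (1 - y) ^+ 2 * (1 + B%:R * (1 - y)) by ring.
have x0' := ltW x0.
by rewrite mulr_ge0 // ?addr_ge0 // mulr_ge0 // exprn_ge0.
Qed.

(** Each 1/(j+1) is at most ln((j+1)/j), by ln(1+x) <= x at x = -1/(j+1); the sum telescopes to
    ln(K+1). *)
Lemma harmonic_le_ln K : (0 < K)%N ->
  \sum_(u < K) u.+2%:R^-1 <= 1 + ln K%:R :> R.
Proof.
have inv_le_ln j : (0 < j)%N -> ln j%:R + j.+1%:R^-1 <= ln j.+1%:R :> R.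
  move=> j0; have j0R : 0 < j%:R :> R by rewrite ltr0n.
  have j1 : 0 < j.+1%:R :> R by [].
  rewrite -lerBrDl -ln_div ?posrE //.
  have := @le_ln1Dx R (- j.+1%:R^-1).
  have -> : 1 + - j.+1%:R^-1 = (j.+1%:R / j%:R)^-1 :> R.
    rewrite invf_div -natr1; field; rewrite natr1; exact: lt0r_neq0.
  rewrite lnV ?posrE ?divr_gt0 // lerN2; apply.
  by rewrite ltrN2 invf_lt1 // ltr1n ltnS.
have : \sum_(u < K) u.+2%:R^-1 <= ln K.+1%:R :> R.
  elim: K => [|K IH]; first by rewrite big_ord0 ln1.
  rewrite big_ord_recr /=; apply: le_trans (inv_le_ln K.+1 isT).
  by rewrite lerD2r.
move=> h K0; apply: le_trans h _; have K0R : 0 < K%:R :> R by rewrite ltr0n.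
rewrite addrC -lerBlDl -ln_div ?posrE //.
have -> : K.+1%:R / K%:R = 1 + K%:R^-1 :> R by rewrite -natr1 mulrDl divff ?gt_eqF // mul1r.
apply: le_trans (le_ln1Dx _) _; last by rewrite invf_le1 // ler1n.
by apply: lt_trans (_ : 0 < _); rewrite ?invr_gt0 // ltrN10.
Qed.

Lemma harmonic_ge0 v : 0 <= \sum_(u < v) u.+2%:R^-1 :> R.
Proof. by apply: sumr_ge0 => u _; rewrite invr_ge0. Qed.

(** Terms past K are at most 1/K. An affine bound in [v] can be summed against geometric weights. *)
Lemma harmonic_affine_le K v : (0 < K)%N ->
  \sum_(u < v) u.+2%:R^-1 <= \sum_(u < K) u.+2%:R^-1 + v%:R / K%:R :> R.
Proof.
move=> K0; have K0R : 0 < K%:R :> R by rewrite ltr0n.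
elim: v => [|v IH].
  by rewrite big_ord0 mul0r addr0 harmonic_ge0.
have [vK|Kv] := leqP v.+1 K.
  apply: ler_wpDr; first by rewrite divr_ge0.
  rewrite -(subnKC vK) big_split_ord /= lerDl.
  by apply: sumr_ge0 => u _; rewrite invr_ge0.
rewrite big_ord_recr /= -[v.+1%:R]natr1 mulrDl addrA mul1r lerD // lef_pV2 ?posrE //.
by rewrite ler_nat; lia.
Qed.

(** Tails are at most y^v with 1 - y >= t/K, so the sums of y^v and v y^v are at most K/t and
    (K/t)^2; the harmonic weights bring in the logarithm. *)
Lemma variance_bound_le s n B K (t : R) : (0 < K)%N -> (B <= n)%N ->
  (s <= n)%N -> 0 < t -> t <= 1 -> t / K%:R <= s%:R / n%:R ->
  variance_bound s n B <= 5 * (1 + ln K%:R) * K%:R / t ^+ 2.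
Proof.
move=> K0 Bn sn t0 t1 ts; have K0R : 0 < K%:R :> R by rewrite ltr0n.
have x0 : 0 < t / K%:R by rewrite divr_gt0.
pose y : R := 1 - s%:R / n%:R.
have n0 : (0 < n)%N.
  by case: n ts {Bn sn y} => // ; rewrite invr0 mulr0; lra.
have y0 : 0 <= y by rewrite subr_ge0 ler_pdivrMr ?ltr0n // mul1r ler_nat.
have yx : y <= 1 - t / K%:R by rewrite /y; lra.
have y1 : y < 1 by lra.
pose H : R := \sum_(u < K) u.+2%:R^-1.
have H0 : 0 <= H by exact: harmonic_ge0.
have HK : H <= 1 + ln K%:R by exact: harmonic_le_ln.
have L0 : 0 <= ln K%:R :> R by rewrite ln_ge0 // ler1n.
apply: (@le_trans _ _ ((1 + 2 * H) * \sum_(v < B) y ^+ v.+1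
    + 2 / K%:R * \sum_(v < B) v%:R * y ^+ v.+1)).
  rewrite [X in _ <= X + _]mulr_sumr [X in _ <= _ + X]mulr_sumr -big_split.
  apply: ler_sum => v _ /=.
  have -> : (1 + 2 * H) * y ^+ v.+1 + 2 / K%:R * (v%:R * y ^+ v.+1)
    = y ^+ v.+1 * (1 + 2 * (H + v%:R / K%:R)) by ring.
  apply: ler_pM; rewrite ?tail_ge0 //.
  - by rewrite addr_ge0 // mulr_ge0 // harmonic_ge0.
  - by apply: tail_le => //; exact: leq_trans Bn.
  - by rewrite lerD2l ler_pM2l // harmonic_affine_le.
have g1 : \sum_(v < B) y ^+ v.+1 <= K%:R / t.
  apply: le_trans (sum_geometric_le _ y0 y1) _.
  apply: (@le_trans _ _ (1 - y)^-1); first by rewrite ler_pdivrMr ?mulVf //; lra.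
  by rewrite -[leRHS]invf_div lef_pV2 ?posrE //; lra.
have g2 : \sum_(v < B) v%:R * y ^+ v.+1 <= (K%:R / t) ^+ 2.
  apply: le_trans (sum_arith_geometric_le _ y0 y1) _.
  rewrite -exprVn lerXn2r ?nnegrE ?invr_ge0 ?divr_ge0 //; try lra.
  by rewrite -[leRHS]invf_div lef_pV2 ?posrE //; lra.
apply: (@le_trans _ _ ((1 + 2 * H) * (K%:R / t) + 2 / K%:R * (K%:R / t) ^+ 2)).
  by apply: lerD; apply: ler_wpM2l; rewrite ?divr_ge0 //; lra.
have -> : 2 / K%:R * (K%:R / t) ^+ 2 = 2 * K%:R / t ^+ 2.
  by field; rewrite !gt_eqF.
(* As t <= 1, all terms are multiples of K/t^2, with total factor 1 + 2 (1 + ln K) + 2 <= 5 (1 + ln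
   K). *)
have tt : K%:R / t <= K%:R / t ^+ 2.
  rewrite ler_pM2l // lef_pV2 ?posrE ?exprn_gt0 // expr2; nra.
have tp : 0 <= K%:R / t ^+ 2 by rewrite divr_ge0 // ltW // exprn_gt0.
rewrite -!mulrA; move: tt tp; set A := _ / t; set B' := _ / t ^+ 2; nra.
Qed.

End Variance.

(** * Concentration of the overlap *)

Section Concentration.
Variable R : realType.

Local Notation E n f := (expect 0 n f (fun=> 0%N)).

(** With x = s/n this is the geometric series in 1 - x, whose leading 1 stands for the root. *)
Lemma mean_count_le s n : (s <= n)%N -> (0 < s)%N ->
  1 + mean_count R s n n <= (s%:R / n%:R)^-1.
Proof.
move=> sn s0; have n0 : 0 < n%:R :> R by rewrite ltr0n; lia.
have s0R : 0 < s%:R :> R by rewrite ltr0n.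
have x0 : 0 < s%:R / n%:R :> R by rewrite divr_gt0.
have x1 : s%:R / n%:R <= 1 :> R by rewrite ler_pdivrMr // mul1r ler_nat.
apply: (@le_trans _ _ (1 + \sum_(v < n) (1 - s%:R / n%:R) ^+ v.+1)).
  by rewrite lerD2l; apply: ler_sum => v _; apply: tail_le.
have -> : (s%:R / n%:R)^-1 =
    1 + (1 - s%:R / n%:R) / (1 - (1 - s%:R / n%:R)) :> R.
  rewrite opprB addrCA subrr addr0 mulrBl mul1r divff ?gt_eqF //.
  by rewrite addrCA subrr addr0.
by rewrite lerD2l sum_geometric_le // ?subr_ge0 // ltrBlDl ltrDr.
Qed.

(** With y = 1 - z/K the sum of y^v over v < K is K (1 - y^K) / z, and y^K <= e^(-z). *)
Lemma mean_count_ge s n K (z : R) : (0 < K)%N -> (s + K <= n)%N -> (K < n)%N ->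
  0 < z -> z <= 1 -> s%:R / (n - K)%N%:R <= z / K%:R ->
  K%:R * ((1 - expR (- z)) / z) <= 1 + mean_count R s n K.-1.
Proof.
move=> K0 sKn Kn z0 z1 sz; have K0R : 0 < K%:R :> R by rewrite ltr0n.
pose y : R := 1 - z / K%:R.
have zK0 : 0 < z / K%:R by rewrite divr_gt0.
have zK1 : z / K%:R <= 1.
  by rewrite ler_pdivrMr // mul1r (le_trans z1) // ler1n.
have y0 : 0 <= y by rewrite subr_ge0.
have geo B : (\sum_(v < B) y ^+ v) * (z / K%:R) = 1 - y ^+ B.
  elim: B => [|B IH]; first by rewrite big_ord0 mul0r expr0 subrr.
  by rewrite big_ord_recr /= mulrDl IH exprS {2 3}/y; ring.
apply: (@le_trans _ _ (\sum_(v < K) y ^+ v)).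
  rewrite -(ler_pM2r zK0) geo.
  have -> : K%:R * ((1 - expR (- z)) / z) * (z / K%:R) = 1 - expR (- z).
    by field; rewrite !gt_eqF.
  rewrite lerD2l lerN2 (_ : - z = K%:R * (- (z / K%:R))); last first.
    by field; rewrite gt_eqF.
  by rewrite expRM_natl lerXn2r ?nnegrE ?expR_ge0 // expR_ge1Dx.
case: K K0 Kn sKn {geo} @y y0 {zK0 zK1} sz K0R => // K _ Kn sKn y y0 sz K0R.
rewrite big_ord_recl expr0 lerD2l; apply: ler_sum => v _ /=.
have vK := ltn_ord v.
apply: le_trans (@tail_ge R s n K.+1 v.+1 _ _ _ _) => //; last lia.
by rewrite lerXn2r ?nnegrE // ?lerD2l ?lerN2 // (le_trans y0) // lerD2l lerN2.
Qed.

(** The tail bound at [n - s] instead of [s] gives (s/n)^w for vertex w. *)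
Lemma dominant_subtree_le s n (z : R) p : parent_map p ->
  (0 < n)%N -> (s <= n)%N -> s%:R / n%:R <= z -> z < 1 ->
  expect 0 n (fun q => \sum_(w < n) (n - s < subtree_size q n w.+1)%N%:R) p
    <= z / (1 - z).
Proof.
move=> hp n0 sn sz z1; have n0R : 0 < n%:R :> R by rewrite ltr0n.
have x0 : 0 <= s%:R / n%:R :> R by rewrite divr_ge0.
apply: (@le_trans _ _ (\sum_(w < n) (s%:R / n%:R) ^+ w.+1)).
  rewrite expect_sum; apply: ler_sum => w _.
  rewrite expect_tail //; apply: le_trans (tail_le _ _ _ _) _ => //.
    exact: leq_subr.
  by rewrite natrB // mulrBl divff ?gt_eqF // opprB addrCA subrr addr0.
apply: le_trans (sum_geometric_le _ x0 _) _; first by apply: le_lt_trans z1.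
rewrite ler_pdivrMr; last by rewrite subr_gt0 (le_lt_trans sz).
rewrite mulrAC ler_pdivlMr ?subr_gt0 //; nra.
Qed.

(** Union bound over three failures: too many large subtrees ([f1]), a dominating subtree off the
    root ([f2]), too few large subtrees among the old vertices ([f3]). The lower bound [t] on s
    controls the mean in [f1], the upper bound [z] those in [f2] and [f3]. *)
Lemma overlap_concentration n s K k (c r t z V : R) :
  (0 < K)%N -> (K < n)%N -> (0 < s)%N -> (s + K <= n)%N ->
  0 < t -> t <= 1 -> 0 < z -> z < 1 ->
  t / K%:R <= s%:R / n%:R -> s%:R / (n - K)%N%:R <= z / K%:R ->
  c * K%:R <= k%:R -> K%:R / t < c * K%:R ->
  r < K%:R * ((1 - expR (- z)) / z) ->
  5 * (1 + ln K%:R) * K%:R / t ^+ 2 <= V ->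
  1 - (V / (c * K%:R - K%:R / t) ^+ 2
       + z / (1 - z) / K%:R
       + V / (K%:R * ((1 - expR (- z)) / z) - r) ^+ 2)
  <= UA_prob R (fun (T : graph n) perm =>
       r <= #|most_central T perm k :&: [set v : 'I_n.+1 | (v < K)%N]|%:R).
Proof.
move=> K0 Kn s0 sKn.
have sn : (s <= n)%N by lia.
have n0 : (0 < n)%N by lia.
have Kn' : (K.-1 <= n)%N by lia.
move=> t0 t1 z0 z1 ts sz ck hc hr hV.
have K0R : 0 < K%:R :> R by rewrite ltr0n.
have n0R : 0 < n%:R :> R by rewrite ltr0n.
have K1 : 1 <= K%:R :> R by rewrite ler1n.
set tau1 := c * K%:R - K%:R / t; set tau2 := _ - r.
have tau1_gt0 : 0 < tau1 by rewrite subr_gt0.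
have tau2_gt0 : 0 < tau2 by rewrite subr_gt0.
apply: le_trans (UA_prob_overlap_ge k r sn K0 (ltnW Kn)).
pose f1 q := (k < (big_count s n n q).+1)%N.
pose f3 q := (big_count s n K.-1 q).+1%:R < r.
pose f2 q : R := \sum_(w < n) (n - s < subtree_size q n w.+1)%N%:R.
have E1 : E n (fun q => (f1 q)%:R) <= V / tau1 ^+ 2.
  apply: le_trans (chebyshev_count (leqnn n) tau1_gt0 _) _; last first.
    apply: ler_wpM2r; first by rewrite invr_ge0 exprn_ge0 // ltW.
    by apply: le_trans hV; exact: (variance_bound_le K0 _ sn t0 t1 ts).
  move=> q; rewrite /f1 -(ltr_nat R) -natr1 => hq.
  suff h : tau1 <= (big_count s n n q)%:R - mean_count R s n n.
    by rewrite lerXn2r ?nnegrE ?(ltW tau1_gt0) // (le_trans (ltW tau1_gt0) h).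
  have := mean_count_le sn s0.
  have : (s%:R / n%:R)^-1 <= K%:R / t.
    have tK0 : 0 < t / K%:R by rewrite divr_gt0.
    by rewrite -[leRHS]invf_div lef_pV2 ?posrE // (lt_le_trans tK0).
  rewrite /tau1; lra.
have nK0 : 0 < (n - K)%N%:R :> R by rewrite ltr0n subn_gt0.
have snz : s%:R / n%:R <= z / K%:R.
  apply: le_trans sz; rewrite ler_wpM2l // lef_pV2 ?posrE // ler_nat.
  exact: leq_subr.
have zK : z / K%:R <= z by rewrite ler_pdivrMr // ler_peMr // ltW.
have E2 : E n f2 <= z / (1 - z) / K%:R.
  apply: le_trans (dominant_subtree_le parent_map0 n0 sn snz (le_lt_trans zK z1)) _.
  rewrite [leLHS]mulrAC ler_pM2r ?invr_gt0 // ler_pM2l //.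
  rewrite lef_pV2 ?posrE ?subr_gt0 //; last exact: le_lt_trans zK z1.
  by rewrite lerD2l lerN2.
have E3 : E n (fun q => (f3 q)%:R) <= V / tau2 ^+ 2.
  apply: le_trans (chebyshev_count (s := s) Kn' tau2_gt0 _) _; last first.
    apply: ler_wpM2r; first by rewrite invr_ge0 exprn_ge0 // ltW.
    by apply: le_trans hV; exact: (variance_bound_le K0 _ sn t0 t1 ts).
  move=> q; rewrite /f3 -natr1 => hq.
  suff h : tau2 <= mean_count R s n K.-1 - (big_count s n K.-1 q)%:R.
    rewrite -[leRHS]sqrrN opprB.
    by rewrite lerXn2r ?nnegrE ?(ltW tau2_gt0) // (le_trans (ltW tau2_gt0) h).
  have := mean_count_ge K0 sKn Kn z0 (ltW z1) sz; rewrite /tau2; lra.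
apply: (@le_trans _ _ (E n (fun q => 1 - ((f1 q)%:R + f2 q + (f3 q)%:R)))).
  by rewrite expectB !expectD expect_cst lerD2l lerN2 !lerD.
apply: expect_le => // q _.
have f2_ge0 : 0 <= f2 q by apply: sumr_ge0.
rewrite /f1 /f3 ltnNge ltNge; case: (boolP (_ <= k)%N) => _ /=; last first.
  by case: (r <= _); rewrite /= ?mulr0n ?mulr1n; lra.
case: (r <= _) => /=; last by case: [forall _, _] => /=; lra.
rewrite andbT; case: forallP => [_|hw] /=; first lra.
suff : 1 <= f2 q by lra.
have /existsP[w] : [exists w : 'I_n, ~~ (subtree_size q n w.+1 <= n - s)%N].
  by rewrite -negb_forall; apply/forallP.
rewrite -ltnNge => hw'; rewrite /f2 (bigD1 w) //= hw' lerDl.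
by apply: sumr_ge0.
Qed.

End Concentration.

(** * The tree with K hubs *)

Definition hub_parent (K : nat) : nat -> nat :=
  fun i => if (i < K)%N then 0%N else (i %% K)%N.

(** Maps that [expect] reaches from the zero map vanish beyond the current time; the cut-off at [M]
    makes the prescribed map literally one of them. *)
Definition restrict_parent (M : nat) (h : nat -> nat) : nat -> nat :=
  fun i => if (i <= M)%N then h i else 0%N.

Section Hubs.
Variables (K : nat) (K0 : (0 < K)%N).

Lemma hub_parent_map : parent_map (hub_parent K).
Proof.
move=> i; rewrite /hub_parent; case: ltnP => // Ki.
by have := ltn_pmod i K0; lia.
Qed.

Lemma descends_hub w v : (0 < w)%N -> (w < K)%N ->
  descends (hub_parent K) w v = (v %% K == w)%N.
Proof.
move=> w0 wK; have small i : (i < K)%N -> descends (hub_parent K) w i = (i == w).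
  move=> iK; rewrite (descendsE _ _ hub_parent_map) eq_sym /hub_parent iK.
  case: (eqVneq i w) => //= _; case: (ltnP 0 i) => //= _.
  by rewrite /descends /= orbF; case: w w0 {wK}.
have [vK|Kv] := ltnP v K; first by rewrite small // modn_small.
rewrite (descends_parent hub_parent_map); [|lia|lia].
by rewrite /hub_parent ltnNge Kv /= small // ltn_pmod.
Qed.

Lemma descends_leaf w v : (K <= w)%N ->
  descends (hub_parent K) w v = (w == v).
Proof.
move=> Kw; rewrite (descendsE _ _ hub_parent_map).
case: eqP => //= _; apply/negP => /andP[_ /(descends_le hub_parent_map)].
by rewrite /hub_parent; case: (ltnP v K) => _; have := ltn_pmod v K0; lia.
Qed.

Lemma sum_mod_eq w r : (w < K)%N -> (\sum_(v < K * r) (v %% K == w) = r)%N.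
Proof.
move=> wK; elim: r => [|r IH]; first by rewrite muln0 big_ord0.
rewrite mulnS addnC big_split_ord /= IH -addn1; congr addn.
rewrite (bigD1 (Ordinal wK)) //= mulnC modnMDl modn_small // eqxx.
rewrite big1 // => i iw; rewrite modnMDl modn_small //.
by apply/eqP; rewrite eqb0; apply: contraNneq iw => iw; apply/eqP/val_inj.
Qed.

Lemma subtree_size_restrict M h u : parent_map h ->
  subtree_size (restrict_parent M h) M u = subtree_size h M u.
Proof.
move=> hh; apply: eq_bigr => v _; congr nat_of_bool.
apply: (@eq_descends _ _ M) => //; last by rewrite -ltnS.
- by move=> i; rewrite /restrict_parent; case: ifP.
- by move=> i iM; rewrite /restrict_parent iM.
Qed.

Lemma subtree_size_hub r w : (0 < r)%N -> (0 < w)%N -> (w < K)%N ->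
  subtree_size (hub_parent K) (K * r).-1 w = r.
Proof.
move=> r0 w0 wK; rewrite /subtree_size prednK ?muln_gt0 ?K0 //.
rewrite -[RHS](sum_mod_eq r wK); apply: eq_bigr => v _.
by rewrite descends_hub.
Qed.

Lemma subtree_size_leaf n w : (K <= w)%N -> (w <= n)%N ->
  subtree_size (hub_parent K) n w = 1%N.
Proof.
move=> Kw wn; rewrite /subtree_size (bigD1 (Ordinal (wn : (w < n.+1)%N))) //=.
rewrite descends_refl big1 // => i iw; rewrite descends_leaf //.
by apply/eqP; rewrite eqb0; apply: contraNneq iw => e; apply/eqP/val_inj.
Qed.

End Hubs.

(** * Success with positive probability for fixed K *)

Section SmallK.
Variable R : realType.

Lemma parent_map_restrict M h : parent_map h -> parent_map (restrict_parent M h).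
Proof. by move=> hh i; rewrite /restrict_parent; case: ifP. Qed.

(** A prescribed history of M attachments has probability 1/M!, as vertex i has i possible
    parents. *)
Lemma expect_ge_path M d (h : nat -> nat) (f : (nat -> nat) -> R) :
  parent_map h -> (forall q, parent_map q -> 0 <= f q) ->
  (M`!)%:R^-1 * expect M d f (restrict_parent M h)
  <= expect 0 (M + d) f (fun=> 0%N).
Proof.
move=> hh f0; elim: M d => [|M IH] d.
  rewrite fact0 invr1 mul1r add0n le_eqVlt; apply/orP; left; apply/eqP.
  congr expect; apply/funext => -[|i]; rewrite /restrict_parent //=.
  by have := hh 0%N; case: (h 0%N).
rewrite addSnnS; apply: le_trans (IH d.+1).
rewrite factS natrM invfM mulrAC mulrC; apply: ler_wpM2l.
  by rewrite invr_ge0.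
have hM : (h M.+1 <= M)%N by exact: hh.
apply: le_trans (expect_le_of_attach _ (parent_map_restrict M hh) hM f0).
rewrite le_eqVlt; apply/orP; left; apply/eqP; congr (_ * expect _ _ _ _).
apply/funext => i; rewrite /restrict_parent /reparent.
by case: (ltngtP i M.+1) => [iM|iM|->]; rewrite ?ltnn //; [rewrite -ltnS iM | rewrite leqNgt ltnW].
Qed.

(** With u = x M the left side is at most e^(-u) (u+1)/x, while 1/x <= u/16 and e^u >= 1 + u^2/2. *)
Lemma exp_decay_le (x : R) M : 0 < x -> x <= 1 -> 16 / x ^+ 2 <= M%:R ->
  (1 - x) ^+ M * (M%:R + x^-1) <= 4^-1.
Proof.
move=> x0 x1 hM; have u1 : 16 / x <= x * M%:R.
  have -> : 16 / x = x * (16 / x ^+ 2) by field; rewrite gt_eqF.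
  by rewrite ler_pM2l.
set u := x * M%:R in u1.
have ux : 16 <= u * x by rewrite -ler_pdivrMr.
have u16 : 16 <= u.
  by apply: le_trans u1; rewrite ler_pdivlMr // ler_piMr.
have e2 : 1 + u ^+ 2 / 2 <= expR u.
  by have := @expR_ge1Dxn R u 1; apply; lra.
apply: (@le_trans _ _ (expR (- u) * (M%:R + x^-1))).
  apply: ler_wpM2r; first by rewrite addr_ge0 // invr_ge0 ltW.
  rewrite (_ : - u = M%:R * - x); last by rewrite /u; ring.
  by rewrite expRM_natl lerXn2r ?nnegrE ?expR_ge0 ?subr_ge0 ?expR_ge1Dx.
rewrite expRN mulrC ler_pdivrMr ?expR_gt0 //.
have -> : M%:R + x^-1 = (u + 1) / x by rewrite /u; field; rewrite gt_eqF.
by rewrite ler_pdivrMr //; nra.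
Qed.

(** [urn_lower_tail] gives s (K r - 1) / ((b-1) n), and K r <= K b <= 2 K (b-1) because b >= 2. *)
Lemma urn_small_fraction s K r n b : (0 < s)%N -> (0 < K)%N -> (1 < r)%N ->
  (r <= b)%N -> (b <= K * r)%N -> (K * r <= n)%N ->
  urn (fun S => (S <= s)%N%:R) (n - (K * r).-1) b (K * r)
  <= 2 * K%:R * (s%:R / n%:R) :> R.
Proof.
move=> s0 K0 r1 rb bK Krn; have b1 : (1 < b)%N by lia.
apply: le_trans (urn_lower_tail _ _ s0 b1 bK) _.
rewrite (_ : (K * r + (n - (K * r).-1)).-1 = n)%N; last lia.
have n0 : 0 < n%:R :> R by rewrite ltr0n; lia.
have b0 : 0 < b.-1%:R :> R by rewrite ltr0n; lia.
rewrite ler_pdivrMr ?mulr_gt0 //.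
have -> : 2 * K%:R * (s%:R / n%:R) * (b.-1%:R * n%:R) = s%:R * (2 * K * b.-1)%N%:R :> R.
  by rewrite !natrM; field; rewrite gt_eqF.
apply: ler_wpM2l => //; rewrite ler_nat.
apply: (@leq_trans (K * b)); last by rewrite -mulnA [leqRHS]mulnCA leq_mul2l; lia.
by apply: leq_trans (leq_pred _) _; rewrite leq_mul2l rb orbT.
Qed.

Section HubEvents.
Variables (s K r n : nat).
Hypotheses (s0 : (0 < s)%N) (r1 : (1 < r)%N) (Krn : (K * r <= n)%N).
Hypothesis K0 : (0 < K)%N.

Local Notation M := (K * r).-1.
Local Notation EH f := (@expect R M (n - M) f (restrict_parent M (hub_parent K))).

Let hp := hub_parent_map K0.
Let rp := parent_map_restrict M hp.

Let ME : M.+1 = (K * r)%N.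
Proof. by rewrite prednK // muln_gt0 K0 ltnW. Qed.

Let Mn : (M <= n)%N.
Proof. by rewrite (leq_trans (leq_pred _)). Qed.

Let KM : (K <= M.+1)%N.
Proof. by rewrite ME leq_pmulr // ltnW. Qed.

Lemma expect_hub_small w : (0 < w)%N -> (w < K)%N ->
  EH (fun q => (subtree_size q n w <= s)%N%:R) <= 2 * K%:R * (s%:R / n%:R) :> R.
Proof.
move=> w0 wK; have wM : (w <= M)%N by rewrite -ltnS (leq_trans wK).
rewrite (expect_subtree (fun S => (S <= s)%N%:R)) //.
rewrite subtree_size_restrict // subtree_size_hub // ?ME; last exact: ltnW.
by apply: urn_small_fraction => //; rewrite leq_pmull.
Qed.

(** Such a hub leaves at most [s] vertices outside its subtree. After a colour swap this is a
    lower-tail event for the complement, which starts with K r - r >= r vertices, as 0 < w < K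
    forces K >= 2. *)
Lemma expect_hub_large w : (s <= n)%N -> (0 < w)%N -> (w < K)%N ->
  EH (fun q => (n - s < subtree_size q n w)%N%:R) <= 2 * K%:R * (s%:R / n%:R) :> R.
Proof.
move=> sn w0 wK; have wM : (w <= M)%N by rewrite -ltnS (leq_trans wK).
have r2 : (r + r <= K * r)%N by rewrite addnn -mul2n leq_mul2r; lia.
rewrite (expect_subtree (fun S => (n - s < S)%N%:R)) //.
rewrite subtree_size_restrict // subtree_size_hub // ?ME; last exact: ltnW.
rewrite urn_compl; [|lia|lia].
apply: le_trans (urn_small_fraction (b := K * r - r) s0 K0 r1 _ _ Krn); [|lia|lia].
apply: urn_le; [lia|lia|] => b.
have -> : (K * r + (n - M) = n.+1)%N by rewrite -ME addSn subnKC.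
by rewrite ler_nat; lia.
Qed.

(** A leaf present at time M evolves like a newborn vertex [M]; a later vertex is newborn on its
    arrival. *)
Lemma expect_leaf_large v : (K <= v)%N -> (v <= n)%N -> (s <= n)%N ->
  EH (fun q => (s < subtree_size q n v)%N%:R) <= (1 - s%:R / n%:R) ^+ maxn M v :> R.
Proof.
move=> Kv vn sn; have [vM|Mv] := leqP v M; last first.
  by rewrite expect_tail_from //; apply: tail_le => //; lia.
rewrite (expect_subtree (fun S => (s < S)%N%:R)) //.
rewrite subtree_size_restrict // subtree_size_leaf //.
by apply: (@tail_le R) => //; lia.
Qed.

(** Failure costs at most 1/8 + 1/8 + 1/4: a hub stays small, a hub dominates, or a non-hub grows
    large. Otherwise the large subtrees are exactly those of the K hubs, the root included. *)
Lemma hub_success k (c' x : R) : (2 * s <= n)%N -> (K <= k)%N -> c' <= 1 ->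
  0 < x -> x <= 1 -> x <= s%:R / n%:R -> 16 / x ^+ 2 <= M%:R ->
  16 * K%:R ^+ 2 * (s%:R / n%:R) <= 1 :> R ->
  2^-1 <= EH (fun q => [&& ((big_count s n n q).+1 <= k)%N,
      [forall w : 'I_n, (subtree_size q n w.+1 <= n - s)%N]
      & c' * K%:R <= (big_count s n K.-1 q).+1%:R]%:R) :> R.
Proof.
move=> s2 Kk.
have sn : (s <= n)%N by lia.
have sns : (s <= n - s)%N by lia.
have K1n : (K.-1 <= n)%N by rewrite (leq_trans _ Mn) // -ltnS prednK.
have n0 : (0 < n)%N by lia.
move=> hc' x0 x1 xs hM hs.
pose f1 q : R := \sum_(w < K.-1) (subtree_size q n w.+1 <= s)%N%:R.
pose f2 q : R := \sum_(w < K.-1) (n - s < subtree_size q n w.+1)%N%:R.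
pose f3 q : R := \sum_(v < n | (K <= v.+1)%N) (s < subtree_size q n v.+1)%N%:R.
have K0R : 0 < K%:R :> R by rewrite ltr0n.
have e0 : 0 <= s%:R / n%:R :> R by rewrite divr_ge0.
have sumK (f : nat -> R) : (forall w, (0 < w)%N -> (w < K)%N ->
    f w <= 2 * K%:R * (s%:R / n%:R)) -> \sum_(w < K.-1) f w.+1 <= 8^-1.
  move=> hf; apply: (@le_trans _ _ (\sum_(w < K.-1) 2 * K%:R * (s%:R / n%:R))).
    by apply: ler_sum => w _; apply: hf => //; rewrite -ltn_predRL.
  rewrite sumr_const card_ord -[_ * _ *+ _]mulr_natl.
  apply: (@le_trans _ _ (K%:R * (2 * K%:R * (s%:R / n%:R)))); last by nra.
  apply: ler_wpM2r; last by rewrite ler_nat leq_pred.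
  by apply: mulr_ge0 => //; apply: mulr_ge0.
have E1 : EH f1 <= 8^-1.
  by rewrite expect_sum; apply: (sumK (fun w => _)) => w; exact: expect_hub_small.
have E2 : EH f2 <= 8^-1.
  by rewrite expect_sum; apply: (sumK (fun w => _)) => w; exact: expect_hub_large.
have E3 : EH f3 <= 4^-1.
  have y0 : 0 <= 1 - x by lra.
  apply: le_trans (exp_decay_le x0 x1 hM).
  apply: (@le_trans _ _ (\sum_(v < n) (1 - x) ^+ maxn M v.+1)).
    rewrite expect_sum big_mkcond; apply: ler_sum => v _ /=.
    case: ifP => Kv; last by rewrite exprn_ge0.
    apply: le_trans (expect_leaf_large Kv _ _) _ => //.
    rewrite lerXn2r ?nnegrE //; last lra.
    by rewrite subr_ge0 ler_pdivrMr ?ltr0n ?mul1r ?ler_nat.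
  (* The first [M] terms contribute M (1-x)^M, the later ones at most (1-x)^M / x. *)
  rewrite -(subnKC Mn) big_split_ord /= mulrDr; apply: lerD.
    apply: (@le_trans _ _ (\sum_(i < M) (1 - x) ^+ M)); last first.
      by rewrite sumr_const card_ord mulr_natr.
    by apply: ler_sum => i _; rewrite (maxn_idPl _).
  apply: (@le_trans _ _ (\sum_(i < n - M) (1 - x) ^+ M * (1 - x) ^+ i.+1)).
    by apply: ler_sum => i _; rewrite (maxn_idPr _) -?exprD ?addnS // leqW // leq_addr.
  rewrite -mulr_sumr ler_wpM2l ?exprn_ge0 //.
  apply: le_trans (sum_geometric_le _ y0 _) _; first by lra.
  rewrite opprB addrCA subrr addr0 ler_pdivrMr // mulVf ?gt_eqF //; lra.
apply: (@le_trans _ _ (EH (fun q => 1 - (f1 q + f2 q + f3 q)))).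
  by rewrite expectB !expectD expect_cst; lra.
apply: expect_le => // q _.
have f1_ge0 : 0 <= f1 q by apply: sumr_ge0.
have f2_ge0 : 0 <= f2 q by apply: sumr_ge0.
have f3_ge0 : 0 <= f3 q by apply: sumr_ge0.
have [[w hw]|h1] := pselect (exists w : 'I_K.-1, (subtree_size q n w.+1 <= s)%N).
  suff : 1 <= f1 q by case: [&& _, _ & _] => /=; lra.
  by rewrite /f1 (bigD1 w) //= hw lerDl; apply: sumr_ge0.
have [[w hw]|h2] := pselect (exists w : 'I_K.-1, (n - s < subtree_size q n w.+1)%N).
  suff : 1 <= f2 q by case: [&& _, _ & _] => /=; lra.
  by rewrite /f2 (bigD1 w) //= hw lerDl; apply: sumr_ge0.
have [[v [Kv hv]]|h3] := pselect (exists v : 'I_n,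
    (K <= v.+1)%N /\ (s < subtree_size q n v.+1)%N).
  suff : 1 <= f3 q by case: [&& _, _ & _] => /=; lra.
  by rewrite /f3 (bigD1 v) //= hv lerDl; apply: sumr_ge0.
have big_hub (w : nat) : (w < K.-1)%N -> (s < subtree_size q n w.+1)%N.
  by move=> wK; rewrite ltnNge; apply/negP => hw; apply: h1; exists (Ordinal wK).
have small_leaf (v : 'I_n) : (K <= v.+1)%N -> (subtree_size q n v.+1 <= s)%N.
  by move=> Kv; rewrite leqNgt; apply/negP => hv; apply: h3; exists v.
have cK : big_count s n K.-1 q = K.-1.
  rewrite /big_count (eq_bigr (fun=> 1%N)) ?sum_nat_const ?card_ord ?muln1 //.
  by move=> w _; rewrite big_hub.
have cn : (big_count s n n q <= K.-1)%N.
  rewrite -[leqRHS]cK /big_count.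
  rewrite -!(big_mkord xpredT (fun v => nat_of_bool (s < subtree_size q n v.+1)%N)).
  rewrite (@big_cat_nat _ _ _ K.-1) //= -[leqRHS]addn0 leq_add2l big_nat_cond big1 //.
  move=> v /andP[/andP[Kv vn] _]; apply/eqP; rewrite eqb0 -leqNgt.
  by apply: (small_leaf (Ordinal vn)); rewrite /= -(prednK K0) ltnS.
suff -> : [&& ((big_count s n n q).+1 <= k)%N,
      [forall w : 'I_n, (subtree_size q n w.+1 <= n - s)%N]
      & c' * K%:R <= (big_count s n K.-1 q).+1%:R] by rewrite /=; lra.
apply/and3P; split.
- by apply: leq_trans Kk; rewrite -(prednK K0) ltnS.
- apply/forallP => w; have [wK|Kw] := ltnP w K.-1.
    by rewrite leqNgt; apply/negP => hw; apply: h2; exists (Ordinal wK).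
  by apply: leq_trans (small_leaf w _) sns; rewrite -(prednK K0) ltnS.
- by rewrite cK prednK // ler_piMl // ltW.
Qed.

End HubEvents.

End SmallK.

(** * Choice of the size threshold and of the constants *)

Section Overlap.
Variable R : realType.

Definition overlap_prob (c r : R) (n K : nat) : R :=
  UA_prob R (fun (T : graph n) s =>
    r <= #|most_central T s `|Num.ceil (c * K%:R)|%N
           :&: [set v : 'I_n.+1 | (v < K)%N]|%:R).

Lemma le_absz_ceil (x : R) : 0 <= x -> x <= `|Num.ceil x|%N%:R.
Proof.
move=> x0; apply: le_trans (ceil_ge x) _.
by rewrite natr_absz ler_int ler_norm.
Qed.

Lemma nat_above (x : R) : exists N : nat, forall n, (N <= n)%N -> x <= n%:R.
Proof.
exists (Num.truncn x).+1 => n hn; apply: le_trans (ltW (truncnS_gt x)) _.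
by rewrite ler_nat.
Qed.

Lemma overlap_prob_ge (c delta : R) : 1 < c -> 0 < delta ->
  exists2 C : R, 0 < C & forall K : nat, (0 < K)%N ->
    exists N : nat, forall n, (N <= n)%N ->
      1 - C * (1 + ln K%:R) / K%:R <=
      overlap_prob c ((c * (1 - expR (- c^-1)) - delta) * K%:R) n K.
Proof.
move=> c1 d0; have c0 : 0 < c by lra.
set e := 1 - expR (- c^-1).
have e0 : 0 < e by rewrite subr_gt0 expR_lt1 oppr_lt0 invr_gt0.
have e1 : e <= 1 by rewrite lerBlDr lerDl expR_ge0.
(* 1/t = c (1-g) and 1/z = c (1-g)^2 will lie strictly between 1 and c. The first bound on g keeps
   the loss in the overlap within delta/2, the second keeps 1/z above 1. *)
pose g := Num.min (delta / (4 * c)) ((c - 1) / (4 * c)).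
have c4 : 0 < 4 * c by lra.
have g0 : 0 < g by rewrite lt_min !divr_gt0 // subr_gt0.
have gd : g * (4 * c) <= delta by rewrite -ler_pdivlMr // ge_min lexx.
have gc : g * (4 * c) <= c - 1 by rewrite -ler_pdivlMr // ge_min lexx orbT.
have g1 : g < 1 by nra.
pose tv := c * (1 - g); pose zv := c * (1 - g) ^+ 2.
have zv1 : 1 < zv by rewrite /zv expr2; nra.
have tzv : zv < tv by rewrite /zv /tv expr2; nra.
have zvc : zv <= c by rewrite /zv expr2; nra.
pose t := tv^-1; pose z := zv^-1.
have t0 : 0 < t by rewrite invr_gt0; lra.
have tz : t < z by rewrite ltf_pV2 ?posrE; lra.
have z1 : z < 1 by rewrite invf_lt1; lra.
have z0 : 0 < z by lra.
have zI : z^-1 = zv by rewrite invrK.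
have zc : c^-1 <= z by rewrite lef_pV2 ?posrE; lra.
have ez : e <= 1 - expR (- z) by rewrite lerD2l lerN2 ler_expR lerN2.
pose C := 5 / (t ^+ 2 * (c * g) ^+ 2) + z / (1 - z)
          + 5 / (t ^+ 2 * (delta / 2) ^+ 2).
have zz : 0 < z / (1 - z) by rewrite divr_gt0 // subr_gt0.
exists C.
  have q1 : 0 < 5 / (t ^+ 2 * (c * g) ^+ 2).
    by rewrite divr_gt0 // mulr_gt0 // exprn_gt0 // mulr_gt0.
  have q2 : 0 < 5 / (t ^+ 2 * (delta / 2) ^+ 2).
    by rewrite divr_gt0 // mulr_gt0 // exprn_gt0 // divr_gt0.
  by rewrite /C; lra.
move=> K K0; have K0R : 0 < K%:R :> R by rewrite ltr0n.
have L0 : 0 <= ln K%:R :> R by rewrite ln_ge0 // ler1n.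
(* For such [n] the interval from t n/K to z (n-K)/K has length at least 1, which leaves room for
   the integer [s]. *)
have [N1 hN1] := nat_above ((1 + z) * K%:R / (z - t)).
exists (maxn N1 K.+1) => n; rewrite geq_max => /andP[/hN1 hn Kn].
pose s := (Num.truncn (t / K%:R * n%:R)).+1.
have n0R : 0 < n%:R :> R by rewrite ltr0n; apply: leq_trans Kn.
have tn0 : 0 <= t / K%:R * n%:R by rewrite mulr_ge0 // divr_ge0 // ltW.
have sl : t / K%:R * n%:R <= s%:R by rewrite ltW // truncnS_gt.
have su : s%:R <= t / K%:R * n%:R + 1 by rewrite /s -natr1 lerD2r truncn_le.
have nKE : (n - K)%N%:R = n%:R - K%:R :> R by rewrite natrB // ltnW.
have nK0 : 0 < (n - K)%N%:R :> R by rewrite ltr0n subn_gt0.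
have szn : s%:R <= z / K%:R * (n - K)%N%:R.
  apply: le_trans su _; rewrite nKE.
  have : (1 + z) * K%:R <= (z - t) * n%:R.
    by rewrite [leRHS]mulrC -ler_pdivrMr // subr_gt0.
  move=> h; rewrite -(ler_pM2r K0R).
  have -> : (t / K%:R * n%:R + 1) * K%:R = t * n%:R + K%:R by field; rewrite gt_eqF.
  have -> : z / K%:R * (n%:R - K%:R) * K%:R = z * (n%:R - K%:R).
    by field; rewrite gt_eqF.
  by move: h; rewrite !mulrBl mulrBr mulrDl mul1r; lra.
have zK1 : z / K%:R <= 1.
  by rewrite ler_pdivrMr // mul1r (le_trans (ltW z1)) // ler1n.
have sKn : (s + K <= n)%N.
  rewrite addnC -leq_subRL ?(ltnW Kn) //.
  rewrite -(ler_nat R); apply: le_trans szn _.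
  by rewrite ler_piMl // ltW.
set r := (_ * K%:R).
(* Both Chebyshev margins are linear in K while [V] is of order K log K, whence the rate (1 + ln
   K)/K. *)
have tau1E : c * K%:R - K%:R / t = c * g * K%:R by rewrite /t invrK /tv; ring.
have tau2 : delta / 2 * K%:R <= K%:R * ((1 - expR (- z)) / z) - r.
  apply: (@le_trans _ _ (K%:R * (e / z) - r)); last first.
    by rewrite lerD2r ler_pM2l // ler_pM2r // invr_gt0.
  rewrite /r zI [K%:R * _]mulrC -mulrBl ler_pM2r // /zv.
  have : e * (g * (4 * c)) <= delta by nra.
  have := sqr_ge0 g; rewrite !expr2 => gg.
  have : 0 <= e * c * (g * g) by rewrite !mulr_ge0 // ltW.
  lra.
pose V := 5 * (1 + ln K%:R) * K%:R / t ^+ 2.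
have V0 : 0 <= V.
  by rewrite divr_ge0 ?exprn_ge0 ?(ltW t0) // mulr_ge0 // mulr_ge0 // addr_ge0.
apply: le_trans (overlap_concentration (s := s) (c := c) (t := t) (z := z) (V := V)
  K0 Kn _ sKn t0 _ z0 z1 _ _ _ _ _ (lexx _)) => //.
- rewrite lerD2l lerN2 tau1E.
  apply: (@le_trans _ _ (V / (c * g * K%:R) ^+ 2 + z / (1 - z) / K%:R
      + V / (delta / 2 * K%:R) ^+ 2)).
    rewrite lerD2l ler_wpM2l // lef_pV2 ?posrE ?exprn_gt0 //.
    + by rewrite lerXn2r ?nnegrE // ?(le_trans _ tau2) // mulr_ge0 // ?divr_ge0 ?ltW.
    + by apply: lt_le_trans tau2; rewrite mulr_gt0 ?divr_gt0.
    + by rewrite mulr_gt0 ?divr_gt0.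
  have -> : V / (c * g * K%:R) ^+ 2 =
      5 / (t ^+ 2 * (c * g) ^+ 2) * (1 + ln K%:R) / K%:R.
    by rewrite /V; field; rewrite !gt_eqF.
  have -> : V / (delta / 2 * K%:R) ^+ 2 =
      5 / (t ^+ 2 * (delta / 2) ^+ 2) * (1 + ln K%:R) / K%:R.
    by rewrite /V; field; rewrite !gt_eqF.
  rewrite -!mulrDl ler_pM2r ?invr_gt0 // /C !mulrDl lerD2r lerD2l.
  by rewrite ler_peMr ?(ltW zz) // lerDl.
- by lra.
- by rewrite ler_pdivlMr.
- by rewrite ler_pdivrMr.
- by rewrite le_absz_ceil // mulr_ge0 // ltW.
- by rewrite -subr_gt0 tau1E !mulr_gt0.
- by rewrite -subr_gt0; apply: lt_le_trans tau2; rewrite mulr_gt0 ?divr_gt0.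
Qed.

Lemma overlap_prob_bounded_below (c c' : R) (K : nat) : 1 < c -> c' <= 1 -> (0 < K)%N ->
  exists2 p : R, 0 < p & exists N : nat, forall n, (N <= n)%N ->
    p <= overlap_prob c (c' * K%:R) n K.
Proof.
move=> c1 hc' K0; have K0R : 0 < K%:R :> R by rewrite ltr0n.
have K1 : 1 <= K%:R :> R by rewrite ler1n.
(* With A = 16 K^2, the threshold s = n / A rounded down satisfies 1/(2A) <= s/n <= 1/A; [x] is the
   lower end. *)
pose x : R := (32 * K%:R ^+ 2)^-1.
have K2 : 1 <= K%:R ^+ 2 :> R by rewrite exprn_ege1.
have x0 : 0 < x by rewrite invr_gt0; lra.
have x1 : x <= 1 by rewrite invf_le1; lra.
have [N1 hN1] := nat_above (16 / x ^+ 2).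
pose r := N1.+2; pose M := (K * r).-1.
have hM : 16 / x ^+ 2 <= M%:R.
  by apply: hN1; rewrite /M; have : (r <= K * r)%N by [rewrite leq_pmull]; rewrite /r; lia.
(* The probability of the hub tree at time [M] times the success probability from there. *)
exists ((M`!)%:R^-1 * 2^-1).
  by rewrite mulr_gt0 ?invr_gt0 // ltr0n fact_gt0.
pose A := (16 * (K * K))%N; have A0 : (0 < A)%N by rewrite /A; lia.
exists (M.+1 + A + A)%N => n hn.
pose s := (n %/ A)%N.
have s0 : (0 < s)%N by rewrite divn_gt0 //; lia.
have sA : (s * A <= n)%N by exact: leq_trunc_div.
have sA' : (n <= 2 * s * A)%N.
  by have := ltn_ceil n A0; rewrite -/s; have : (A <= s * A)%N by [rewrite leq_pmull]; lia.
have n0 : (0 < n)%N by lia.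
have s2 : (2 * s <= n)%N.
  by apply: leq_trans sA; rewrite mulnC leq_mul2l; apply/orP; right; rewrite /A; lia.
have Mn : (M <= n)%N by lia.
have KM : (K <= M.+1)%N by rewrite /M prednK ?muln_gt0 ?K0 // leq_pmulr.
have Krn : (K * r <= n)%N.
  by rewrite -[(K * r)%N]prednK ?muln_gt0 ?K0 // -/M; lia.
have n0R : 0 < n%:R :> R by rewrite ltr0n.
have AE : A%:R = 16 * K%:R ^+ 2 :> R by rewrite /A !natrM expr2.
have hs : 16 * K%:R ^+ 2 * (s%:R / n%:R) <= 1 :> R.
  by rewrite mulrA ler_pdivrMr // mul1r -AE -natrM ler_nat mulnC.
have xs : x <= s%:R / n%:R.
  rewrite ler_pdivlMr // mulrC ler_pdivrMr; last lra.
  have -> : 32 * K%:R ^+ 2 = 2 * A%:R :> R by rewrite AE; ring.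
  by rewrite -!natrM ler_nat mulnCA mulnA.
have ceilK : (K <= `|Num.ceil (c * K%:R)|)%N.
  rewrite -(ler_nat R); apply: le_trans (le_absz_ceil _); last by rewrite mulr_ge0 //; lra.
  by rewrite ler_peMl // ltW.
have sn : (s <= n)%N by apply: leq_trans s2; rewrite leq_pmull.
have Kn : (K <= n)%N by apply: leq_trans Krn; rewrite leq_pmulr.
apply: le_trans (UA_prob_overlap_ge _ _ sn K0 Kn).
have e : (M + (n - M) = n)%N by rewrite subnKC.
apply: le_trans (le_trans (expect_ge_path M (n - M) (hub_parent_map K0) _) _); last first.
- by rewrite e.
- by move=> q _; rewrite ler0n.
rewrite ler_wpM2l ?invr_ge0 //.
exact: (hub_success s0 _ Krn K0 s2 ceilK hc' x0 x1 xs hM hs).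
Qed.

End Overlap.

(** * From rates in K to the condition on eps *)

(** The quadratic term L^2/8 of the exponential is at least 2 C L + L/8, which dominates C (1 +
    L). *)
Lemma affine_le_expR_half (R : realType) (C L : R) : 0 < C -> 16 * C + 1 <= L ->
  C * (1 + L) <= expR (L / 2).
Proof.
move=> C0 hL; apply: (@le_trans _ _ (1 + (L / 2) ^+ 2 / 2)).
  by rewrite !expr2; nra.
have := @expR_ge1Dxn R (L / 2) 1; apply; lra.
Qed.

(* The hypothesis C / eps * ln (1 / eps) <= K is monotone in eps, and at
   eps = D (1 + ln K) / K it fails as soon as C > 4 D and K is large. *)
Lemma eps_ge_rate (R : realType) (C D eps : R) (K : nat) :
  0 < D -> 4 * D < C -> expR (16 * D + 1) <= K%:R -> 0 < eps ->
  C / eps * ln (1 / eps) <= K%:R -> D * (1 + ln K%:R) / K%:R <= eps.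
Proof.
move=> D0 DC hK e0 hCK; rewrite leNgt; apply/negP => he.
have K0 : 0 < K%:R :> R by apply: lt_le_trans hK; exact: expR_gt0.
set L := ln K%:R in he.
(* The contradiction: eps < e^(-L/2) gives ln(1/eps) > L/2, so C L/2 < K eps < D (1 + L), against C
   > 4 D and L >= 1. *)
have KE : K%:R = expR L :> R by rewrite lnK.
have hL : 16 * D + 1 <= L by rewrite -ler_expR -KE.
have L1 : 1 <= L by lra.
have eL : eps < expR (- (L / 2)).
  apply: lt_le_trans he _; rewrite ler_pdivrMr // KE -expRD.
  have -> : - (L / 2) + L = L / 2 by field.
  exact: affine_le_expR_half.
have lnL : L / 2 < ln (1 / eps).
  rewrite div1r lnV ?posrE // ltrNr -[ltRHS]expRK ltr_ln ?posrE ?expR_gt0 //.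
have heK : eps * K%:R < D * (1 + L) by rewrite -ltr_pdivlMr.
have : C * ln (1 / eps) <= K%:R * eps.
  by rewrite -ler_pdivrMr // mulrAC.
nra.
Qed.

(** ln(1/eps) >= 1 - eps, and C ln(1/eps) <= K eps <= K. For bounded K, a large C makes the required
    probability small. *)
Lemma one_sub_eps_le (R : realType) (C eps K : R) : 0 < C -> 0 < eps -> eps < 1 ->
  0 <= K -> C / eps * ln (1 / eps) <= K -> 1 - eps <= K / C.
Proof.
move=> C0 e0 e1 K0 h; rewrite ler_pdivlMr //.
have hl : 1 - eps <= ln (1 / eps).
  rewrite div1r lnV ?posrE // lerNr opprB.
  have := @le_ln1Dx R (eps - 1); rewrite addrCA subrr addr0; apply; lra.
have : C * ln (1 / eps) <= K * eps by rewrite -ler_pdivrMr // mulrAC.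
nra.
Qed.

Unset Strict Implicit.
Unset Printing Implicit Defensive.

Import Order.TTheory GRing.Theory Num.Theory.
Local Open Scope ring_scope.

Theorem theorem1p5 (R : realType) (c delta : R) (hc : 1 < c)
    (hdelta : 0 < delta) :
  let c' := c * (1 - expR (- c^-1)) - delta in
  exists (C : R) (n0 : nat -> nat),
    forall eps : R, 0 < eps ->
    forall K : nat, (0 < K)%N -> C / eps * ln (1 / eps) <= K%:R ->
    forall n : nat, (n0 K <= n)%N ->
      1 - eps <= UA_prob R (fun (T : graph n) s =>
        c' * K%:R <=
          #|most_central T s `|Num.ceil (c * K%:R)|%N
            :&: [set v : 'I_n.+1 | (v < K)%N]|%:R).
Proof.
move=> c'; have c0 : 0 < c by lra.
(* From e^(-1/c) >= 1 - 1/c; so the K hubs alone give the required overlap. *)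
have c'1 : c' <= 1.
  have := expR_ge1Dx (- c^-1); have cV : c * c^-1 = 1 by rewrite mulfV // gt_eqF.
  by rewrite /c'; nra.
have [D D0 hD] := overlap_prob_ge hc hdelta.
(* Choice makes the thresholds and probabilities functions of K alone, fixed before eps; the values
   at K = 0 are dummies. *)
have /choice[N hN] (K : nat) : exists N : nat, (0 < K)%N -> forall n, (N <= n)%N ->
    1 - D * (1 + ln K%:R) / K%:R <= overlap_prob c (c' * K%:R) n K.
  case: K => [|K]; first by exists 0%N.
  by have [N hN] := hD K.+1 isT; exists N.
have /choice[p hp] (K : nat) : exists p : R, 0 < p /\ ((0 < K)%N ->
    exists N : nat, forall n, (N <= n)%N -> p <= overlap_prob c (c' * K%:R) n K).
  case: K => [|K]; first by exists 1.
  by have [p p0 hp] := overlap_prob_bounded_below hc c'1 (ltn0Sn K); exists p.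
have /choice[N' hN'] (K : nat) : exists N : nat, (0 < K)%N ->
    forall n, (N <= n)%N -> p K <= overlap_prob c (c' * K%:R) n K.
  case: K => [|K]; first by exists 0%N.
  by have [_ /(_ isT)[N' hN']] := hp K.+1; exists N'.
have [K1 hK1] := nat_above (expR (16 * D + 1)).
(* [S] dominates 1/p(K) for every K < K1, so C >= K/p(K) there; the summand 4 D + 1 serves
   [eps_ge_rate] for K >= K1. *)
pose S := \sum_(K < K1) (p K)^-1.
have S0 : 0 <= S by apply: sumr_ge0 => K _; rewrite invr_ge0 ltW //; case: (hp K).
pose C := 4 * D + 1 + K1%:R * S.
have C0 : 0 < C by rewrite /C; have : 0 <= K1%:R * S by [exact: mulr_ge0]; lra.
exists C, (fun K => maxn (N K) (N' K)) => eps e0 K K0 hCK n.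
rewrite geq_max => /andP[hn hn'].
have [e1|e1] := leP 1 eps.
  apply: (@le_trans _ _ 0); first lra.
  rewrite /UA_prob UA_expect; apply: expect_ge0 => // q _.
  by apply: sumr_ge0 => s _; rewrite mulr_ge0 ?invr_ge0 ?ler0n.
have [KK1|K1K] := ltnP K K1; last first.
  apply: le_trans (hN K K0 n hn); rewrite lerD2l lerN2.
  apply: (eps_ge_rate D0 _ (hK1 _ K1K) e0 hCK).
  by rewrite /C; have : 0 <= K1%:R * S by [exact: mulr_ge0]; lra.
apply: le_trans (hN' K K0 n hn').
apply: le_trans (one_sub_eps_le C0 e0 e1 _ hCK) _ => //.
have pK0 : 0 < p K by case: (hp K).
rewrite ler_pdivrMr // -ler_pdivrMl //.
have KS : (p K)^-1 <= S.
  rewrite /S (bigD1 (Ordinal KK1)) //= lerDl.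
  by apply: sumr_ge0 => i _; rewrite invr_ge0 ltW //; case: (hp i).
apply: (@le_trans _ _ (K1%:R * S)); last by rewrite /C; lra.
rewrite mulrC; apply: ler_pM => //; first by rewrite invr_ge0 ltW.
by rewrite ler_nat ltnW.
Qed.
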